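(* The direct systems $\mathcal{A}$ in $\mathcal{F}_2$ and in $\mathcal{F}_3$ are classified up to regular isomorphism by the scaled ordered group invariant $(G(\mathcal{A}),S_{mu}(\mathcal{A}))$, where $S_{mu}(\mathcal{A})$ is the matrix unit scale. That is, for $r\in\{2,3\}$ and $\mathcal{A},\mathcal{A}'\in\mathcal{F}_r$, the systems $\mathcal{A}$ and $\mathcal{A}'$ are regularly isomorphic if and only if there is an isomorphism of scaled ordered groups $\Phi:G(\mathcal{A})\to G(\mathcal{A}')$ which carries $S_{mu}(\mathcal{A})$ onto $S_{mu}(\mathcal{A}')$ (with $\Phi$ applied coordinatewise).
   Context: $T_r$ is the algebra of upper triangular $r\times r$ complex matrices, with matrix units $e_{ij}$, $1\le i\le j\le r$. A $T_r$-algebra is a block $r\times r$ upper triangular matrix algebra, i.e. the algebra of all block upper triangular matrices in $M_n(\mathbb{C})$ for some partition $n=n_1+\dots+n_r$, $n_a\ge1$; let $P_1,\dots,P_r$ be the block diagonal projections. A homomorphism between such algebras is star-extendible if it is the restriction of a $*$-homomorphism between the generated $C^*$-algebras (full matrix algebras); it is multiplicity one if it maps rank one matrix units to rank one operators, and a star-extendible homomorphism is regular if it is a direct sum of multiplicity one star-extendible embeddings. Systems. $\mathcal{F}_r$ is the family of direct systems $\mathcal{A}=\{A_k,\alpha_k\}$ of $T_r$-algebras with regular star-extendible maps $\alpha_k:A_k\to A_{k+1}$. Systems $\mathcal{A},\mathcal{A}'$ are regularly isomorphic if there are subsystems $A_1\to A_{n_1}\to A_{n_2}\to\cdots$ and $A'_1\to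 A'_{m_1}\to A'_{m_2}\to\cdots$ (horizontal maps the compositions of the given ones) and star-extendible regular maps $\phi_1:A_1\to A'_{m_1}$, $\psi_1:A'_{m_1}\to A_{n_1}$, $\phi_2:A_{n_1}\to A'_{m_2}$, $\psi_2:A'_{m_2}\to A_{n_2},\dots$ making all triangles commute. Dimension distribution group. For a $T_r$-algebra $A$, $G(A)=T_r(\mathbb{Z})$ (the additive group of upper triangular integer $r\times r$ matrices) with positive cone $T_r(\mathbb{Z}_+)$. A partial isometry $v\in A$ with $v^*v,vv^*\in A$ that normalises a masa of $M_n(\mathbb{C})$ contained in $A$ has class $[v]=(\mathrm{rank}(P_a v P_b))_{a\le b}\in G(A)$; the scale $\Sigma(A)$ is the set of all such classes. A regular star-extendible $\phi:A_1\to A_2$ induces the group homomorphism $G(\phi):G(A_1)\to G(A_2)$ with $G(\phi)[e]=[\phi(e)]$ for matrix units $e$ chosen so that $\phi$ maps matrix units to sums of matrix units. $G(\mathcal{A})=\varinjlim(G(A_k),G(\alpha_k))$, with positive cone and scale $\Sigma(\mathcal{A})$ the unions of the images of the $G(A_k)_+$ and of the $\Sigma(A_k)$. An isomorphism of scaled ordered groups carries positive cone onto positive cone and scale onto scale. Matrix unit scale. For a $T_r$-algebra $A$ the matrix unit scale is the set of all elements $\prod_{1\le i\le j\le r}[\phi(e_{ij})]$ of $\Sigma(A)^{r(r+1)/2}$, where $\phi$ ranges over regular star-extendible homomorphisms $T_r\to A$. $S_{mu}(\mathcal{A})\subseteq\Sigma(\mathcal{A})^{r(r+1)/2}$ is the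 union of the images of the matrix unit scales of the $A_k$. *)

(* Defs.v *)
From HB Require Import structures.
From mathcomp Require Import all_boot all_order all_algebra.
From mathcomp Require Import complex.
From mathcomp Require Import boolp classical_sets reals.

Set Implicit Arguments.
Unset Strict Implicit.
Unset Printing Implicit Defensive.

Import Order.TTheory GRing.Theory Num.Theory.
Local Open Scope classical_set_scope.
Local Open Scope ring_scope.
Local Open Scope complex_scope.

(* Direct limit of a sequence f_0, f_1, ... of endomorphisms of one abelian
   group V.  A single V suffices below because every group in the sequences
   considered is T_r(Z).  The pair (k, x) stands for x in the k-th group. *)
Section DirectLimit.
Variables (V : zmodType) (f : nat -> {additive V -> V}).

Fixpoint dl_map (k d : nat) (x : V) : V :=
  if d is d'.+1 then f (d' + k)%N (dl_map k d' x) else x.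

Definition dl_rel (x y : nat * V) : bool :=
  `[< exists p q, (p + x.1 = q + y.1)%N /\
        dl_map x.1 p x.2 = dl_map y.1 q y.2 >].

Lemma dl_mapD k p q x : dl_map k (q + p) x = dl_map (p + k) q (dl_map k p x).
Proof. by elim: q => //= q ->; rewrite addnA. Qed.

Lemma dl_map_add k d x y : dl_map k d (x + y) = dl_map k d x + dl_map k d y.
Proof. by elim: d => //= d ->; rewrite raddfD. Qed.

Lemma dl_map0 k d : dl_map k d 0 = 0.
Proof. by elim: d => //= d ->; rewrite raddf0. Qed.

Lemma dl_mapN k d x : dl_map k d (- x) = - dl_map k d x.
Proof. by elim: d => //= d ->; rewrite raddfN. Qed.

Lemma dl_rel_refl : reflexive dl_rel.
Proof. by move=> x; apply/asboolP; exists 0%N, 0%N. Qed.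

Lemma dl_rel_sym : symmetric dl_rel.
Proof.
by move=> x y; apply/asboolP/asboolP => -[p [q [e h]]]; exists q, p; split.
Qed.

Lemma dl_rel_trans : transitive dl_rel.
Proof.
move=> [l y] [k x] [m z] /asboolP[p [q [/= e1 h1]]] /asboolP[s [t [/= e2 h2]]].
apply/asboolP; exists (s + p)%N, (q + t)%N; split => /=.
  by rewrite -addnA e1 addnCA e2 addnA.
by rewrite !dl_mapD h1 -h2 e1 -e2 -!dl_mapD addnC.
Qed.

Canonical dl_equiv := EquivRel dl_rel dl_rel_refl dl_rel_sym dl_rel_trans.

Definition dirlim := {eq_quot dl_equiv}%qT.

HB.instance Definition _ := Choice.on dirlim.

Definition dl_inj (k : nat) (x : V) : dirlim := (\pi_dirlim (k, x))%qT.

Lemma dl_injP k x l y : reflect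
  (exists p q, (p + k = q + l)%N /\ dl_map k p x = dl_map l q y)
  (dl_inj k x == dl_inj l y).
Proof. by rewrite /dl_inj eqmodE; apply: asboolP. Qed.

Lemma dl_inj_map k d x : dl_inj (d + k) (dl_map k d x) = dl_inj k x.
Proof. by apply/eqP/dl_injP; exists 0%N, d. Qed.

Lemma dl_inj_mapE n k d x : n = (d + k)%N ->
  dl_inj n (dl_map k d x) = dl_inj k x.
Proof. by move->; apply: dl_inj_map. Qed.

Lemma dl_injK (u : dirlim) : dl_inj (repr u).1 (repr u).2 = u.
Proof. by rewrite /dl_inj -surjective_pairing reprK. Qed.

Definition dl_add (u v : dirlim) : dirlim :=
  let: (k, x) := repr u in let: (l, y) := repr v in
  dl_inj (l + k) (dl_map k l x + dl_map l k y).
Definition dl_zero : dirlim := dl_inj 0 0.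
Definition dl_opp (u : dirlim) : dirlim :=
  let: (k, x) := repr u in dl_inj k (- x).

Lemma dl_inj_add k x l y : dl_add (dl_inj k x) (dl_inj l y) =
  dl_inj (l + k) (dl_map k l x + dl_map l k y).
Proof.
rewrite /dl_add.
move: (repr (dl_inj k x)) (repr (dl_inj l y))
  (dl_injK (dl_inj k x)) (dl_injK (dl_inj l y)) => [k' x'] [l' y'] /=.
move=> /eqP/dl_injP[s [t [e2 h2]]] /eqP/dl_injP[p [q [e1 h1]]].
apply/eqP/dl_injP; exists (p + s)%N, (q + t)%N; split.
  by rewrite addnACA e1 e2 -addnACA.
rewrite !dl_map_add; congr (_ + _).
- rewrite -!dl_mapD.
  have -> : (p + s + l' = p + l' + s)%N by rewrite addnAC.
  have -> : (q + t + l = q + l + t)%N by rewrite addnAC.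
  by rewrite dl_mapD h2 e2 e1 -dl_mapD.
- rewrite [(l' + _)%N]addnC [(l + _)%N]addnC -!dl_mapD.
  have -> : (p + s + k' = s + k' + p)%N by rewrite -addnA addnC.
  have -> : (q + t + k = t + k + q)%N by rewrite -addnA addnC.
  by rewrite dl_mapD h1 e1 e2 -dl_mapD.
Qed.

Lemma dl_inj_opp k x : dl_opp (dl_inj k x) = dl_inj k (- x).
Proof.
have := dl_injK (dl_inj k x); rewrite /dl_opp.
case: (repr _) => k' x' /= /eqP/dl_injP[p [q [e h]]].
by apply/eqP/dl_injP; exists p, q; split; rewrite // !dl_mapN h.
Qed.

Lemma dl_addA : associative dl_add.
Proof.
move=> u v w; rewrite -(dl_injK u) -(dl_injK v) -(dl_injK w).
move: (repr u) (repr v) (repr w) => [k x] [l y] [m z] /=.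
rewrite !dl_inj_add !dl_map_add addrA addnA -!dl_mapD.
congr (dl_inj _ (_ + _ + _)).
  by rewrite [(l + k)%N]addnC -dl_mapD addnC.
by rewrite [(m + l)%N]addnC -dl_mapD addnC.
Qed.

Lemma dl_addC : commutative dl_add.
Proof.
move=> u v; rewrite -(dl_injK u) -(dl_injK v).
by rewrite !dl_inj_add addrC addnC.
Qed.

Lemma dl_add0 : left_id dl_zero dl_add.
Proof.
move=> u; rewrite -(dl_injK u) /dl_zero dl_inj_add dl_map0 add0r /=.
by rewrite addn0.
Qed.

Lemma dl_addN : left_inverse dl_zero dl_opp dl_add.
Proof.
move=> u; rewrite -(dl_injK u) dl_inj_opp dl_inj_add dl_mapN addNr.
by rewrite -[in LHS](dl_map0 0 ((repr u).1 + (repr u).1)) dl_inj_mapE // addn0.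
Qed.

HB.instance Definition _ :=
  GRing.isZmodule.Build dirlim dl_addA dl_addC dl_add0 dl_addN.

End DirectLimit.

Section UpperTriangular.
Variable r : nat.

Definition upper (g : 'M[int]_r) : bool :=
  [forall i : 'I_r, forall j : 'I_r, (j < i)%N ==> (g i j == 0)].

(* T_r(Z), as an additive group *)
Record utmx := UTmx { utval :> 'M[int]_r; utvalP : upper utval }.

HB.instance Definition _ := [isSub for utval].
HB.instance Definition _ := [Choice of utmx by <:].

Lemma upper_zmod_closed : zmod_closed upper.
Proof.
split=> [|g h gU hU].
  by apply/forallP => i; apply/forallP => j; rewrite mxE eqxx implybT.
apply/'forall_forallP => i j; apply/implyP => ji.
move/'forall_forallP: gU => /(_ i j)/implyP/(_ ji)/eqP gij.
move/'forall_forallP: hU => /(_ i j)/implyP/(_ ji)/eqP hij.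
by rewrite !mxE gij hij subrr.
Qed.
HB.instance Definition _ := GRing.isZmodClosed.Build _ upper upper_zmod_closed.
HB.instance Definition _ := [SubChoice_isSubZmodule of utmx by <:].

Lemma trunc_upper (F : 'I_r -> 'I_r -> int) :
  upper (\matrix_(i, j) if (i <= j)%N then F i j else 0).
Proof.
apply/'forall_forallP => i j; apply/implyP => ji.
by rewrite mxE leqNgt ji eqxx.
Qed.

Definition utmx_of (F : 'I_r -> 'I_r -> int) : utmx := UTmx (trunc_upper F).

Definition utmx_ge0 : set utmx := [set g | forall i j, 0 <= utval g i j].

Definition upair : Type := {p : 'I_r * 'I_r | (p.1 <= p.2)%N}.

End UpperTriangular.

(* A partition n = n_1 + ... + n_r into positive parts; it determines a
   T_r-algebra.  The coordinate s : 'I_n lies in the block tagnat.sig1 s. *)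
Record Talg (r : nat) := MkTalg {
  bdim : 'I_r -> nat;
  bdim_gt0 : forall a, (0 < bdim a)%N
}.

Definition tdim r (A : Talg r) : nat := (\sum_a bdim A a)%N.

Definition Tr (r : nat) : Talg r := @MkTalg r (fun=> 1%N) (fun=> isT).

Section Algebras.
Variable R : realType.
Local Notation C := R[i].

Definition adjmx m n (X : 'M[C]_(m, n)) : 'M[C]_(n, m) :=
  map_mx Num.conj X^T.

Definition star_hom m n (Phi : 'M[C]_m -> 'M[C]_n) : Prop :=
  [/\ linear Phi,
      forall X Y, Phi (X *m Y) = Phi X *m Phi Y &
      forall X, Phi (adjmx X) = adjmx (Phi X)].

Definition star_subalg n (D : set 'M[C]_n) : Prop :=
  [/\ D 0,
      forall (c : C) X Y, D X -> D Y -> D (c *: X + Y),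
      forall X Y, D X -> D Y -> D (X *m Y) &
      forall X, D X -> D (adjmx X)].

Definition abelian_star_subalg n (D : set 'M[C]_n) : Prop :=
  star_subalg D /\ forall X Y, D X -> D Y -> X *m Y = Y *m X.

Definition masa n (D : set 'M[C]_n) : Prop :=
  abelian_star_subalg D /\
  forall E : set 'M[C]_n, abelian_star_subalg E -> D `<=` E -> E = D.

Definition normalises n (v : 'M[C]_n) (D : set 'M[C]_n) : Prop :=
  forall X, D X -> D (v *m X *m adjmx v) /\ D (adjmx v *m X *m v).

Definition partial_isometry n (v : 'M[C]_n) : Prop := v *m adjmx v *m v = v.

Section WithR.
Variable r : nat.
Implicit Types A B : Talg r.

Definition bproj A (a : 'I_r) : 'M[C]_(tdim A) :=
  diag_mx (\row_s (tagnat.sig1 s == a)%:R).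

Definition talg A : set 'M[C]_(tdim A) :=
  [set X | forall a b : 'I_r, (b < a)%N -> bproj A a *m X *m bproj A b = 0].
Arguments talg A : clear implicits.

(* Homomorphisms A -> B are represented by functions on the full matrix
   algebras of which only the values on A are ever used. *)
Definition star_extendible A B (phi : 'M[C]_(tdim A) -> 'M[C]_(tdim B)) : Prop :=
  exists Phi : 'M[C]_(tdim A) -> 'M[C]_(tdim B),
    [/\ star_hom Phi,
        forall X, talg A X -> talg B (Phi X) &
        forall X, talg A X -> phi X = Phi X].

Definition multiplicity_one A B (phi : 'M[C]_(tdim A) -> 'M[C]_(tdim B)) : Prop :=
  forall s t, talg A (delta_mx s t) -> \rank (phi (delta_mx s t)) = 1%N.

(* The summands have mutually orthogonal ranges, i.e. the projections
   phi_i(1) are mutually orthogonal.  The empty sum is allowed, so the zero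
   homomorphism is regular. *)
Definition regular A B (phi : 'M[C]_(tdim A) -> 'M[C]_(tdim B)) : Prop :=
  star_extendible phi /\
  exists (N : nat) (phis : 'I_N -> 'M[C]_(tdim A) -> 'M[C]_(tdim B)),
    [/\ forall i, star_extendible (phis i) /\ multiplicity_one (phis i),
        forall i j, i != j -> phis i 1%:M *m phis j 1%:M = 0 &
        forall X, talg A X -> phi X = \sum_i phis i X].

Definition cls A (v : 'M[C]_(tdim A)) : utmx r :=
  utmx_of (fun a b => (\rank (bproj A a *m v *m bproj A b))%:Z).

Definition scale A : set (utmx r) :=
  [set cls v | v in [set v : 'M[C]_(tdim A) |
     [/\ talg A v, partial_isometry v,
         talg A (adjmx v *m v), talg A (v *m adjmx v) &
         exists D, [/\ masa D, D `<=` talg A & normalises v D]]]].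

(* the standard matrix unit in the top left corner of the block (a, b) *)
Definition munit A (a b : 'I_r) : 'M[C]_(tdim A) :=
  delta_mx (tagnat.Rank a (Ordinal (bdim_gt0 A a)))
           (tagnat.Rank b (Ordinal (bdim_gt0 A b))).

(* The additive extension of [e] |-> [phi(e)].  For regular phi the
   standard matrix units are carried to sums of matrix units, for a suitable
   matrix unit system of B, and [phi(e)] depends only on the block of e. *)
Definition Gmap A B (phi : 'M[C]_(tdim A) -> 'M[C]_(tdim B))
    (g : utmx r) : utmx r :=
  \sum_(a < r) \sum_(b < r | (a <= b)%N) cls (phi (munit A a b)) *~ utval g a b.

Lemma Gmap_is_zmod A B (phi : 'M[C]_(tdim A) -> 'M[C]_(tdim B)) :
  zmod_morphism (Gmap phi).
Proof.
move=> g h; rewrite /Gmap -sumrB; apply: eq_bigr => a _.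
rewrite -sumrB; apply: eq_bigr => b _.
by rewrite -mulrzBr !mxE.
Qed.
HB.instance Definition _ A B (phi : 'M[C]_(tdim A) -> 'M[C]_(tdim B)) :=
  GRing.isZmodMorphism.Build _ _ (Gmap phi) (Gmap_is_zmod phi).

Record system := MkSystem {
  alg : nat -> Talg r;
  smap : forall k, 'M[C]_(tdim (alg k)) -> 'M[C]_(tdim (alg k.+1));
  smap_regular : forall k, regular (@smap k)
}.
Implicit Types S T : system.

Fixpoint strans S (k d : nat) :
    'M[C]_(tdim (alg S k)) -> 'M[C]_(tdim (alg S (d + k))) :=
  if d is d'.+1 then fun X => @smap S (d' + k)%N (@strans S k d' X)
  else fun X => X.

(* the strictly increasing sequence from 0 with successive gaps d_i + 1 *)
Fixpoint subidx (d : nat -> nat) (i : nat) : nat :=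
  if i is i'.+1 then ((d i').+1 + subidx d i')%N else 0%N.

Definition subalg S (d : nat -> nat) (i : nat) : Talg r := alg S (subidx d i).

Definition submap S (d : nat -> nat) (i : nat) :
    'M[C]_(tdim (subalg S d i)) -> 'M[C]_(tdim (subalg S d i.+1)) :=
  @strans S (subidx d i) (d i).+1.
Arguments submap S d i : clear implicits.

(* Both subsystems start with the first algebra; the first algebra of T is
   not linked to S, as phi_0 maps into the second term of the subsystem. *)
Definition regularly_isomorphic S T : Prop :=
  exists (d e : nat -> nat)
    (phi : forall i, 'M[C]_(tdim (subalg S d i)) ->
                     'M[C]_(tdim (subalg T e i.+1)))
    (psi : forall i, 'M[C]_(tdim (subalg T e i.+1)) ->
                     'M[C]_(tdim (subalg S d i.+1))),
    [/\ forall i, regular (phi i),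
        forall i, regular (psi i),
        forall i X, talg (subalg S d i) X ->
          psi i (phi i X) = submap S d i X &
        forall i Y, talg (subalg T e i.+1) Y ->
          phi i.+1 (psi i Y) = submap T e i.+1 Y].

Definition Gseq S (k : nat) : {additive utmx r -> utmx r} :=
  Gmap (@smap S k).

Definition G S : zmodType := dirlim (Gseq S).

Definition Ginj S (k : nat) : utmx r -> G S := @dl_inj _ (Gseq S) k.

Definition Gpos S : set (G S) := \bigcup_k (Ginj S k @` @utmx_ge0 r).

Definition Gscale S : set (G S) := \bigcup_k (Ginj S k @` scale (alg S k)).

Arguments Gpos S : clear implicits.
Arguments Gscale S : clear implicits.

Definition mu_scale A : set (upair r -> utmx r) :=
  [set (fun p => cls (phi (munit (Tr r) (val p).1 (val p).2))) |
    phi in [set phi : 'M[C]_(tdim (Tr r)) -> 'M[C]_(tdim A) | regular phi]].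

Definition Gmu_scale S : set (upair r -> G S) :=
  \bigcup_k [set Ginj S k \o s | s in mu_scale (alg S k)].

Arguments Gmu_scale S : clear implicits.

Definition scaled_order_iso S T (Phi : {additive G S -> G T}) : Prop :=
  [/\ bijective Phi, Phi @` Gpos S = Gpos T & Phi @` Gscale S = Gscale T].

End WithR.
End Algebras.

Arguments talg R {r} A.
Arguments Gpos {R r} S.
Arguments Gscale {R r} S.
Arguments Gmu_scale {R r} S.

(* Main.v *)
(* A multiplicity one star-extendible map A -> B has the form
   X |-> V X V^*, where V is an isometry which carries the a-th block of A into
   the block g a of B for a monotone map g of the block indices.  A regular map
   is therefore described, up to conjugation by a block diagonal unitary of B,
   by the number of its summands with each monotone map g, and the induced map
   on G records how many summands take the pair (a, b) to (c, d).  For r <= 3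
   these pair counts determine the numbers of summands, so two regular maps
   with the same induced map are conjugate.

   An isomorphism of the invariants sends the matrix units of a copy of T_r in
   A_k to the images of the matrix units under some regular map T_r -> A'_l,
   which provides a family of monotone maps; since the class of the unit of A_k
   is sent into the scale, far enough along A' there is room for a regular map
   A_k -> A'_l with this family.  Correcting these maps by block diagonal
   unitaries gives an intertwining of the two systems.  In the converse
   direction the scale of A consists of the nonnegative matrices with row and
   column sums at most the block sizes, because a masa contained in A contains
   the block projections; this description is preserved by regular maps. *)

From Stdlib Require Eqdep_dec.
From HB Require Import structures.
Require Import Defs.
From mathcomp Require Import all_boot all_order all_algebra spectral complex.
From mathcomp Require Import boolp classical_sets reals.

Set Implicit Arguments.
Unset Strict Implicit.
Unset Printing Implicit Defensive.

Import Order.TTheory GRing.Theory Num.Theory.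
Local Open Scope classical_set_scope.
Local Open Scope ring_scope.
Local Open Scope complex_scope.

(** * Projections and partial isometries *)

(** Each fibre of [p] is listed, and its elements go to those at the same positions in the list of
    the corresponding fibre of [q]. This supplies isometries with prescribed blocks and matchings
    between families of maps. *)
Lemma fiber_injection (X Y : finType) (K : eqType) (p : X -> K) (q : Y -> K) :
    (forall k, #|[pred x | p x == k]| <= #|[pred y | q y == k]|)%N ->
  exists h : X -> Y, injective h /\ forall x, q (h x) = p x.
Proof.
move=> le_pq; case: (pickP (@predT X)) => [x0 _|X0]; last first.
  have h : X -> Y by move=> x; have := X0 x.
  by exists h; split=> [x|x]; have := X0 x.
have /card_gt0P[y0 _] : (0 < #|[pred y | q y == p x0]|)%N.
  by apply: leq_trans (le_pq _); apply/card_gt0P; exists x0; rewrite inE.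
pose ex x := enum [pred x' | p x' == p x].
pose ey x := enum [pred y | q y == p x].
pose h x := nth y0 (ey x) (index x (ex x)).
have ltix x : (index x (ex x) < size (ey x))%N.
  rewrite -cardE (leq_trans _ (le_pq _)) // cardE index_mem.
  by rewrite mem_enum inE.
have hq x : q (h x) = p x.
  by apply/eqP; have := mem_nth y0 (ltix x); rewrite mem_enum inE.
exists h; split=> // x x' eqh.
have eqp : p x = p x' by rewrite -!hq eqh.
have [exE eyE] : ex x' = ex x /\ ey x' = ey x by rewrite /ex /ey eqp.
move: eqh (ltix x) (ltix x'); rewrite /h exE eyE => eqh ltx ltx'.
move/eqP: eqh; rewrite nth_uniq ?enum_uniq // => /eqP eqi.
have xin : x \in ex x by rewrite mem_enum inE.
have x'in : x' \in ex x by rewrite mem_enum inE eqp.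
by rewrite -(nth_index x xin) eqi nth_index.
Qed.

Section Adjoint.
Variable R : realType.
Local Notation C := R[i].

Lemma adjmxE m n (X : 'M[C]_(m, n)) i j : adjmx X i j = Num.conj (X j i).
Proof. by rewrite !mxE. Qed.

Lemma adjmxK m n (X : 'M[C]_(m, n)) : adjmx (adjmx X) = X.
Proof. by apply/matrixP => i j; rewrite !mxE conjCK. Qed.

Lemma adjmxM m n p (X : 'M[C]_(m, n)) (Y : 'M[C]_(n, p)) :
  adjmx (X *m Y) = adjmx Y *m adjmx X.
Proof. by rewrite /adjmx trmx_mul map_mxM. Qed.

Lemma adjmxD m n (X Y : 'M[C]_(m, n)) : adjmx (X + Y) = adjmx X + adjmx Y.
Proof. by rewrite /adjmx linearD /= map_mxD. Qed.

Lemma adjmxB m n (X Y : 'M[C]_(m, n)) : adjmx (X - Y) = adjmx X - adjmx Y.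
Proof. by rewrite /adjmx linearB /= map_mxB. Qed.

Lemma adjmx0 m n : adjmx (0 : 'M[C]_(m, n)) = 0.
Proof. by rewrite /adjmx trmx0 map_mx0. Qed.

Lemma adjmx1 n : adjmx (1%:M : 'M[C]_n) = 1%:M.
Proof. by rewrite /adjmx trmx1 map_mx1. Qed.

Lemma adjmx_sum (I : Type) (r : seq I) (P : pred I) m n
    (F : I -> 'M[C]_(m, n)) :
  adjmx (\sum_(i <- r | P i) F i) = \sum_(i <- r | P i) adjmx (F i).
Proof. exact: (big_morph _ (@adjmxD m n) (adjmx0 m n)). Qed.

Lemma adjmx_delta m n i j :
  adjmx (delta_mx i j : 'M[C]_(m, n)) = delta_mx j i.
Proof. by rewrite /adjmx trmx_delta map_delta_mx. Qed.

Lemma adjmx_diag n (u : 'I_n -> bool) :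
  adjmx (diag_mx (\row_s (u s)%:R) : 'M[C]_n) = diag_mx (\row_s (u s)%:R).
Proof.
apply/matrixP => i j; rewrite !mxE [j == i]eq_sym.
by case: eqP => [->|_]; rewrite ?mulr1n ?mulr0n ?conjC0 // conjC_nat.
Qed.

Definition proj n (E : 'M[C]_n) : Prop := E *m E = E /\ adjmx E = E.

(** Gram-Schmidt on a row basis of [E] gives [S] with orthonormal rows spanning the row space of
    [E]. Then [S E = S] and [E S^* S = E]; the adjoint of the second identity yields [S^* S = E]. *)
Lemma proj_factor n (E : 'M[C]_n) : proj E ->
  exists Y : 'M[C]_(n, \rank E), adjmx Y *m Y = 1%:M /\ Y *m adjmx Y = E.
Proof.
case=> EE Ead; pose S := schmidt (row_base E).
have SU : S *m adjmx S = 1%:M.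
  by apply/unitarymxP/schmidt_unitarymx/rank_leq_col.
have SE : (S :=: E)%MS.
  by apply: (eqmx_trans (eqmx_schmidt_free _)) (eq_row_base E);
    apply: row_base_free.
exists (adjmx S); rewrite adjmxK; split=> //.
have /submxP[Z eZ] : (S <= E)%MS by rewrite SE.
have /submxP[W eW] : (E <= S)%MS by rewrite SE.
have h1 : S *m E = S by rewrite eZ -mulmxA EE.
have h2 : E *m (adjmx S *m S) = E.
  by rewrite {1}eW mulmxA -(mulmxA W) SU mulmx1 -eW.
have := congr1 (@adjmx R _ _) h2.
by rewrite !adjmxM adjmxK Ead -mulmxA h1.
Qed.

(** Turns ranks into traces, which are additive and cyclic. *)
Lemma proj_rank n (E : 'M[C]_n) : proj E -> (\rank E)%:R = \tr E.
Proof.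
move=> /proj_factor[Y [Y1 YE]].
by rewrite -{2}YE mxtrace_mulC Y1 mxtrace1.
Qed.

Lemma partial_isometry_proj n (v : 'M[C]_n) :
  partial_isometry v -> proj (adjmx v *m v).
Proof.
move=> hv; split; last by rewrite adjmxM adjmxK.
by rewrite -mulmxA (mulmxA v) hv.
Qed.

Lemma partial_isometry_rank n (v : 'M[C]_n) : partial_isometry v ->
  (\rank v)%:R = \tr (adjmx v *m v).
Proof.
move=> hv; rewrite -proj_rank; last exact: partial_isometry_proj.
congr (_%:R); apply/eqP; rewrite eqn_leq mxrankM_maxr andbT.
by rewrite -{1}hv -mulmxA mxrankM_maxr.
Qed.

(** Murray-von Neumann equivalence: equal traces give equal ranks, so both projections factor
    through isometries defined on the same space. *)
Lemma proj_equiv n (E F : 'M[C]_n) : proj E -> proj F -> \tr E = \tr F ->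
  exists Z, adjmx Z *m Z = E /\ Z *m adjmx Z = F.
Proof.
move=> pE pF; rewrite -!proj_rank // => /eqP; rewrite eqr_nat => /eqP eqr.
have [Y [Y1 YE]] := proj_factor pE; have [Z [Z1 ZF]] := proj_factor pF.
move: Z Z1 ZF; rewrite -eqr => Z Z1 ZF.
exists (Z *m adjmx Y); rewrite adjmxM adjmxK; split.
  by rewrite mulmxA -(mulmxA Y) Z1 mulmx1.
by rewrite mulmxA -(mulmxA Z) Y1 mulmx1.
Qed.

Lemma adjmx_mul_eq0 m n (X : 'M[C]_(m, n)) : adjmx X *m X = 0 -> X = 0.
Proof.
move=> XX0; apply/matrixP => i j; rewrite mxE; apply/eqP.
move/matrixP: XX0 => /(_ j j) /eqP; rewrite !mxE psumr_eq0; last first.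
  by move=> k _; rewrite adjmxE mulrC mul_conjC_ge0.
move=> /allP/(_ i); rewrite mem_index_enum => /(_ isT) /=.
by rewrite adjmxE mulf_eq0 conjC_eq0 orbb.
Qed.

(** With [P = Z^* Z], the matrix [W = Z (P - 1)] satisfies [W^* W = (P - 1) P (P - 1) = 0]. *)
Lemma partial_isometry_of_proj n (Z : 'M[C]_n) :
  proj (adjmx Z *m Z) -> partial_isometry Z.
Proof.
case=> ZZ _; apply/eqP; rewrite -subr_eq0; apply/eqP/adjmx_mul_eq0.
have -> : Z *m adjmx Z *m Z - Z = Z *m (adjmx Z *m Z - 1%:M).
  by rewrite mulmxBr mulmx1 mulmxA.
rewrite adjmxM -mulmxA (mulmxA (adjmx Z)) mulmxBr mulmx1 ZZ subrr.
exact: mulmx0.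
Qed.

End Adjoint.

(** * Block structure *)

Section Spatial.
Variable R : realType.
Local Notation C := R[i].
Variable r : nat.
Implicit Types A B D : Talg r.

Definition blk A (s : 'I_(tdim A)) : 'I_r := tagnat.sig1 s.
Arguments blk : clear implicits.

Lemma card_blk A a : #|[pred s | blk A s == a]| = bdim A a.
Proof.
have Rinj : injective (@tagnat.Rank _ (bdim A) a).
  move=> k k' /(congr1 val)/eqP; rewrite /= tagnat.eq_Rank eqxx => /eqP.
  exact: val_inj.
rewrite -[RHS]card_ord -[RHS](card_image Rinj).
apply: eq_card => s; rewrite inE; apply/eqP/fintype.imageP => [|[k _ ->]].
  by move=> {Rinj} <-; exists (tagnat.sig2 s) => //; rewrite tagnat.sig2K.
exact: tagnat.Rank1K.
Qed.

(** [bproj] for an arbitrary set of coordinates: pulling a block projection back along an isometry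
    gives a matrix of this form. *)
Definition selmx n (u : pred 'I_n) : 'M[C]_n := diag_mx (\row_s (u s)%:R).

Lemma selmx_mull m n (u : pred 'I_m) (X : 'M[C]_(m, n)) s t :
  (selmx u *m X) s t = X s t *+ u s.
Proof. by rewrite mul_diag_mx !mxE mulr_natl. Qed.

Lemma selmx_mulr m n (X : 'M[C]_(m, n)) (u : pred 'I_n) s t :
  (X *m selmx u) s t = X s t *+ u t.
Proof. by rewrite mul_mx_diag !mxE mulr_natr. Qed.

Lemma selmxM n (u w : pred 'I_n) :
  selmx u *m selmx w = selmx (predI u w).
Proof.
apply/matrixP => s t; rewrite selmx_mull !mxE /=.
by case: (u s); case: (w s); case: (s == t); rewrite ?mulr1n ?mulr0n ?mul0rn.
Qed.

Lemma selmx_proj n (u : pred 'I_n) : proj (selmx u).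
Proof.
split; last exact: adjmx_diag.
by rewrite selmxM; congr diag_mx; apply/matrixP => i j; rewrite !mxE /= andbb.
Qed.

Lemma selmx_tr n (u : pred 'I_n) : \tr (selmx u) = #|u|%:R.
Proof.
by rewrite mxtrace_diag -sum1_card natr_sum [RHS]big_mkcond /=; apply: eq_bigr
  => s _; rewrite mxE -[s \in u]/(u s); case: (u s).
Qed.

Lemma bprojE A a : bproj R A a = selmx (fun s => blk A s == a).
Proof. by []. Qed.

Lemma sum_bproj A : \sum_a bproj R A a = 1%:M.
Proof.
apply/matrixP => s t; rewrite summxE (bigD1 (blk A s)) //= big1 => [|a ne].
  by rewrite !mxE eqxx addr0.
by rewrite !mxE eq_sym (negbTE ne) mul0rn.
Qed.

Lemma bproj_orth A a b :
  bproj R A a *m bproj R A b = if a == b then bproj R A a else 0.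
Proof.
rewrite !bprojE selmxM; apply/matrixP => s t; rewrite !mxE /=.
case: ifP => [/eqP->|ne]; rewrite !mxE ?andbb //.
by case: (blk A s =P a) => [->|_]; rewrite /= ?ne mul0rn.
Qed.

Lemma talgP A (X : 'M[C]_(tdim A)) :
  talg R A X <-> forall s t, (blk A t < blk A s)%N -> X s t = 0.
Proof.
split=> [AX s t lt_ts|AX a b lt_ba]; last first.
  apply/matrixP => s t; rewrite !bprojE selmx_mulr selmx_mull mxE.
  case: (blk A t =P b) => [tb|_]; rewrite ?mulr0n //.
  by case: (blk A s =P a) => [sa|_]; rewrite ?mul0rn // AX // tb sa.
move/matrixP: (AX _ _ lt_ts) => /(_ s t).
by rewrite !bprojE selmx_mulr selmx_mull !eqxx mxE.
Qed.

Lemma talg_delta A s t : (blk A s <= blk A t)%N -> talg R A (delta_mx s t).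
Proof.
move=> le_st; apply/talgP => s' t' lt_ts; rewrite mxE.
by case: eqP => // es; case: eqP => // et; move: lt_ts; rewrite es et ltnNge le_st.
Qed.

Lemma talg1 A : talg R A 1%:M.
Proof.
by apply/talgP => s t lt_ts; rewrite mxE; case: eqP => // e; move: lt_ts;
  rewrite e ltnn.
Qed.

(** [V] carries block [a] of [A] into block [g a] of [B]. For [A = B] and [g] the identity, this
    says that [V] is block diagonal. *)
Definition blockwise A B (V : 'M[C]_(tdim B, tdim A)) (g : 'I_r -> 'I_r) :=
  forall j s, V j s != 0 -> blk B j = g (blk A s).

Lemma blockwise_bproj A B (V : 'M[C]_(tdim B, tdim A)) g c : blockwise V g ->
  bproj R B c *m V = V *m selmx (fun s => g (blk A s) == c).
Proof.
move=> Vg; apply/matrixP => j s; rewrite bprojE selmx_mull selmx_mulr.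
by have [->|/Vg->] := eqVneq (V j s) 0; rewrite ?mul0rn.
Qed.

Lemma blockwise_adj_bproj A B (V : 'M[C]_(tdim B, tdim A)) g c : blockwise V g ->
  adjmx V *m bproj R B c = selmx (fun s => g (blk A s) == c) *m adjmx V.
Proof.
move=> Vg; have := congr1 (@adjmx R _ _) (blockwise_bproj c Vg).
by rewrite !adjmxM ![adjmx (diag_mx _)](proj2 (selmx_proj _)).
Qed.

(** Moving the block projections through [V] leaves the entries of [X] between blocks with images
    [c] and [d], where [d < c]. By monotonicity these lie below the block diagonal, where [X]
    vanishes. *)
Lemma blockwise_conj_talg A B (V : 'M[C]_(tdim B, tdim A)) g X :
    blockwise V g -> {homo g : a b / (a <= b)%N} -> talg R A X ->
  talg R B (V *m X *m adjmx V).
Proof.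
move=> Vg g_mono /talgP AX c d lt_dc.
rewrite !mulmxA (blockwise_bproj _ Vg) -!mulmxA (blockwise_adj_bproj _ Vg).
rewrite (mulmxA X) (mulmxA (selmx _)).
suff -> : selmx (fun s => g (blk A s) == c) *m
    (X *m selmx (fun s => g (blk A s) == d)) = 0 by rewrite mul0mx mulmx0.
apply/matrixP => s t; rewrite selmx_mull selmx_mulr mxE.
case: (g (blk A t) =P d) => [td|_]; last by rewrite mulr0n mul0rn.
case: (g (blk A s) =P c) => [sc|_]; last by rewrite mulr0n.
rewrite AX ?mul0rn // ltnNge; apply/negP => /g_mono.
by rewrite td sc leqNgt lt_dc.
Qed.

Lemma conj_star_hom A B (V : 'M[C]_(tdim B, tdim A)) :
  adjmx V *m V = 1%:M -> star_hom (fun X => V *m X *m adjmx V).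
Proof.
move=> VV; split=> [a X Y|X Y|X].
- by rewrite linearP /= mulmxDl -scalemxAl.
- rewrite -!mulmxA; congr (V *m (X *m _)).
  by rewrite (mulmxA (adjmx V)) VV mul1mx.
- by rewrite !adjmxM adjmxK mulmxA.
Qed.

End Spatial.
Arguments blk {r} A s.

(** * The form of regular maps *)

Section Regular.
Variable R : realType.
Local Notation C := R[i].
Variable r : nat.
Implicit Types A B D : Talg r.

(** The predicate [J] keeps some of the summands, as a compression by block projections does on a
    matrix unit. *)
Definition amp m n (I : finType) (V : I -> 'M[C]_(m, n)) (J : pred I) X :=
  \sum_(i | J i) V i *m X *m adjmx (V i).

Section Amplification.
Variables (m n : nat) (I : finType) (V : I -> 'M[C]_(m, n)) (J : pred I).
Hypothesis VV : forall i j, adjmx (V i) *m V j = (i == j)%:R%:M.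

Lemma amp_adj X : adjmx (amp V J X) = amp V J (adjmx X).
Proof.
by rewrite adjmx_sum; apply: eq_bigr => i _; rewrite !adjmxM adjmxK mulmxA.
Qed.

Lemma ampM X Y : amp V J X *m amp V J Y = amp V J (X *m Y).
Proof.
rewrite mulmx_suml; apply: eq_bigr => i Ji; rewrite mulmx_sumr (bigD1 i) //=.
rewrite big1 => [|j /andP[_ ne_ji]].
  by rewrite addr0 -!mulmxA (mulmxA (adjmx (V i)) (V i)) VV eqxx mul1mx.
rewrite -!mulmxA (mulmxA (adjmx (V i)) (V j)) VV eq_sym (negbTE ne_ji).
by rewrite raddf0 mul0mx !mulmx0.
Qed.

Lemma amp_tr X : \tr (amp V J X) = \tr X *+ #|J|.
Proof.
rewrite raddf_sum /= -sumr_const; apply: eq_bigr => i _.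
by rewrite -mulmxA mxtrace_mulC -mulmxA VV eqxx mulmx1.
Qed.

(** Amplification preserves partial isometries, so the rank is the trace of the amplified [X^* X],
    and traces get multiplied by the number of summands. *)
Lemma amp_rank X : partial_isometry X -> \rank (amp V J X) = (\rank X * #|J|)%N.
Proof.
move=> pX; apply/eqP; rewrite -(eqr_nat C) natrM !partial_isometry_rank //.
  by rewrite amp_adj ampM amp_tr mulr_natr.
by rewrite /partial_isometry amp_adj !ampM pX.
Qed.

End Amplification.

(** The columns of [V] are the images of one unit vector under the partial isometries
    [Phi (e s s0)]. Matrix units below the block diagonal are reached through the extension [Phi];
    that [Phi] respects the triangular algebras yields the block map [g]. *)
Lemma multiplicity_one_conj A B (phi : 'M[C]_(tdim A) -> 'M[C]_(tdim B)) :
    'I_r -> star_extendible phi -> multiplicity_one phi ->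
  exists (V : 'M[C]_(tdim B, tdim A)) (g : {ffun 'I_r -> 'I_r}),
    [/\ {homo g : a b / (a <= b)%N}, adjmx V *m V = 1%:M, blockwise V g &
        forall X, talg R A X -> phi X = V *m X *m adjmx V].
Proof.
move=> a0 [Phi [[Plin PM Padj] PA Pphi]] phi1.
pose L : {linear 'M[C]_(tdim A) -> 'M[C]_(tdim B)} :=
  HB.pack Phi (GRing.isLinear.Build _ _ _ _ Phi Plin).
pose top a := @tagnat.Rank _ (bdim A) a (Ordinal (bdim_gt0 A a)).
have blk_top a : blk A (top a) = a by apply: tagnat.Rank1K.
pose s0 := top a0.
pose e s t : 'M[C]_(tdim A) := delta_mx s t.
have Pe s t t' u : Phi (e s t) *m Phi (e t' u) = Phi (e s u) *+ (t == t').
  by rewrite -PM mul_delta_mx_cond; apply: (raddfMn L).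
have Pad s t : adjmx (Phi (e s t)) = Phi (e t s) by rewrite -Padj adjmx_delta.
have pE0 : proj (Phi (e s0 s0)) by split; rewrite ?Pad // Pe eqxx.
have rk1 : \rank (Phi (e s0 s0)) = 1%N.
  have Ae : talg R A (e s0 s0) by apply: talg_delta.
  by rewrite -Pphi //; apply: phi1.
have [Y] := proj_factor pE0; move: Y; rewrite rk1 => Y [Y1 YE].
(* [Y] is a unit vector spanning the range of the rank one projection [Phi (e s0 s0)]. *)
pose V : 'M[C]_(tdim B, tdim A) := \matrix_(j, s) (Phi (e s s0) *m Y) j 0.
have VeE s : V *m delta_mx s (0 : 'I_1) = Phi (e s s0) *m Y.
  by rewrite -colE; apply/matrixP => j k; rewrite !ord1 !mxE.
clearbody V.
have VE s t : V *m e s t *m adjmx V = Phi (e s t).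
  transitivity (V *m delta_mx s (0 : 'I_1) *m adjmx (V *m delta_mx t (0 : 'I_1))).
    by rewrite adjmxM adjmx_delta mulmxA -(mulmxA V (delta_mx _ _) (delta_mx _
      _)) mul_delta_mx.
  by rewrite !VeE adjmxM mulmxA -(mulmxA _ Y) YE Pad Pe eqxx mulr1n Pe eqxx.
have PhiE X : L X = V *m X *m adjmx V.
  rewrite (matrix_sum_delta X).
  rewrite raddf_sum mulmx_sumr mulmx_suml.
  apply: eq_bigr => s _; rewrite raddf_sum mulmx_sumr mulmx_suml.
  apply: eq_bigr => t _; rewrite -scalemxAr -scalemxAl VE; apply: (linearZZ L).
have VV : adjmx V *m V = 1%:M.
  apply/matrixP => s t.
  have -> : (adjmx V *m V) s t =
      (adjmx (V *m delta_mx s (0 : 'I_1)) *m (V *m delta_mx t (0 : 'I_1))) 0 0.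
    rewrite adjmxM adjmx_delta mulmxA -(mulmxA _ (adjmx V)) -colE -rowE.
    by rewrite !mxE.
  rewrite !VeE adjmxM -mulmxA (mulmxA (adjmx (Phi _))) Pad Pe.
  have -> : adjmx Y *m (Phi (e s0 s0) *+ (s == t) *m Y) = 1%:M *+ (s == t).
    case: (s == t); last by rewrite mulr0n mul0mx mulmx0.
    by rewrite !mulr1n -YE -mulmxA Y1 mulmx1.
  by case: (s =P t) => [->|/eqP/negbTE st]; rewrite !mxE ?eqxx ?st.
have Vcol s : exists j, V j s != 0.
  apply/existsP; apply: contraT; rewrite negb_exists => /forallP V0.
  have := oner_eq0 C; rewrite -[1](_ : (1%:M : 'M[C]_(tdim A)) s s = 1); last first.
    by rewrite !mxE eqxx.
  rewrite -VV mxE big1 ?eqxx // => j _.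
  by have /negPn/eqP-> := V0 j; rewrite mulr0.
(* The entry of [Phi (e s t) = V e_st V^*] at [(j, k)] is [V j s] times the conjugate of [V k t],
   hence nonzero, and [Phi (e s t)] is block upper triangular. *)
have Vle s t j k : (blk A s <= blk A t)%N -> V j s != 0 -> V k t != 0 ->
    (blk B j <= blk B k)%N.
  move=> /(talg_delta R)/PA/talgP Pst Vj Vk; rewrite leqNgt; apply/negP.
  move=> /Pst/eqP; rewrite -VE.
  have -> : V *m e s t *m adjmx V = col s V *m adjmx (col t V).
    by rewrite !colE adjmxM adjmx_delta mulmxA -(mulmxA V (delta_mx _ _)
      (delta_mx _ _)) mul_delta_mx.
  by rewrite mxE big_ord1 !mxE mulf_eq0 conjC_eq0 (negbTE Vj) (negbTE Vk).
pose g := [ffun a => blk B (xchoose (Vcol (top a)))].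
have gP a : V (xchoose (Vcol (top a))) (top a) != 0 := xchooseP (Vcol (top a)).
exists V, g; split=> // [a b le_ab|j s Vjs|X AX]; last by rewrite Pphi // -PhiE.
  by rewrite !ffunE; apply: (Vle (top a) (top b)); rewrite ?blk_top.
(* Coordinates in one block of [A] are comparable both ways, so the nonzero entries of their columns
   all lie in one block of [B]. *)
apply/val_inj/eqP; rewrite ffunE eqn_leq; apply/andP; split.
  by apply: Vle Vjs (gP _); rewrite blk_top.
by apply: Vle (gP _) Vjs; rewrite blk_top.
Qed.

(** Normal form of a regular map: isometries with mutually orthogonal ranges, each moving blocks by
    a monotone map. Up to unitary conjugation and on the invariant, only the family [f] matters. *)
Definition spatial A B (phi : 'M[C]_(tdim A) -> 'M[C]_(tdim B)) (I : finType)
    (V : I -> 'M[C]_(tdim B, tdim A)) (f : I -> {ffun 'I_r -> 'I_r}) :=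
  [/\ forall i, {homo f i : a b / (a <= b)%N},
      forall i j, adjmx (V i) *m V j = (i == j)%:R%:M,
      forall i, blockwise (V i) (f i) &
      forall X, talg R A X -> phi X = \sum_i V i *m X *m adjmx (V i)].

Lemma conj_eq0 m n (V W : 'M[C]_(m, n)) :
    adjmx V *m V = 1%:M -> adjmx W *m W = 1%:M ->
  (V *m adjmx V) *m (W *m adjmx W) = 0 <-> adjmx V *m W = 0.
Proof.
move=> VV WW; split=> [VW0|VW0].
  rewrite -[adjmx V *m W]mul1mx -[LHS]mulmx1 -{1}VV -{1}WW.
  by rewrite !mulmxA -!mulmxA (mulmxA V) (mulmxA W) (mulmxA (V *m _)) VW0
    mul0mx mulmx0.
by rewrite -mulmxA (mulmxA (adjmx V)) VW0 mul0mx mulmx0.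
Qed.

Lemma regular_spatial A B (phi : 'M[C]_(tdim A) -> 'M[C]_(tdim B)) :
    'I_r -> regular phi ->
  exists (N : nat) (V : 'I_N -> 'M[C]_(tdim B, tdim A)) f, spatial phi V f.
Proof.
move=> a0 [_ [N [phis [phis1 phis_orth phiE]]]].
have /choice[V /choice[f Vf]] i :=
  multiplicity_one_conj a0 (phis1 i).1 (phis1 i).2.
exists N, V, f; split=> [i|i j|i|X AX]; try by case: (Vf i).
  have [_ VVi _ phiEi] := Vf i; have [_ VVj _ phiEj] := Vf j.
  have [<-|ne_ij] := eqVneq i j; first by rewrite VVi.
  rewrite raddf0; apply/(conj_eq0 VVi VVj).
  have := phis_orth _ _ ne_ij; rewrite phiEi ?phiEj; try exact: talg1.
  by rewrite !mulmx1.
by rewrite phiE //; apply: eq_bigr => i _; case: (Vf i) => _ _ _ ->.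
Qed.

Lemma spatial_regular A B (phi : 'M[C]_(tdim A) -> 'M[C]_(tdim B))
    (I : finType) (V : I -> 'M[C]_(tdim B, tdim A)) f :
  spatial phi V f -> regular phi.
Proof.
case=> f_mono VV Vf phiE; have VV1 i : adjmx (V i) *m V i = 1%:M.
  by rewrite VV eqxx.
split.
  exists (amp V predT); split=> // [|X AX].
    split=> [a X Y|X Y|X]; [|by rewrite ampM|by rewrite amp_adj].
    rewrite /amp scaler_sumr -big_split; apply: eq_bigr => i _ /=.
    by rewrite linearP /= mulmxDl -scalemxAl.
  apply/talgP => s t lt_ts; rewrite summxE big1 // => i _.
  by move: s t lt_ts; apply/talgP/(blockwise_conj_talg (Vf i)).
exists #|I|, (fun k X => V (enum_val k) *m X *m adjmx (V (enum_val k))).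
split=> [k|k l ne_kl|X AX].
- split; last first.
    (* Conjugation by an isometry is undone by conjugation with its adjoint, so it neither raises
       nor lowers ranks. *)
    move=> s t _; apply/eqP; rewrite eqn_leq.
    rewrite -[X in (_ <= X)%N && _](mxrank_delta C s t).
    rewrite (leq_trans (mxrankM_maxl _ _)) ?mxrankM_maxr //=.
    rewrite -[X in (X <= _)%N](mxrank_delta C s t).
    have {1}-> : delta_mx s t = adjmx (V (enum_val k)) *m
        (V (enum_val k) *m delta_mx s t *m adjmx (V (enum_val k))) *m V
          (enum_val k).
      by rewrite !mulmxA VV1 mul1mx -mulmxA VV1 mulmx1.
    by rewrite (leq_trans (mxrankM_maxl _ _)) ?mxrankM_maxr.
  exists (fun X => V (enum_val k) *m X *m adjmx (V (enum_val k))).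
  split=> //; first exact: conj_star_hom.
  by move=> X; apply: blockwise_conj_talg.
- rewrite !mulmx1; apply/conj_eq0 => //.
  by rewrite VV (inj_eq enum_val_inj) (negbTE ne_kl) raddf0.
by rewrite phiE // (reindex (@enum_val I I)) //; apply/onW_bij/enum_val_bij.
Qed.

End Regular.

(** * Induced maps on dimension distribution groups *)

Section UpperUnits.
Variable r : nat.

(** The class of a matrix unit in block [(a, b)]. For [b < a] the truncation in [utmx_of] makes it
    zero, whence the conditions [a <= b] below. *)
Definition Gunit (a b : 'I_r) : utmx r :=
  utmx_of (fun c d => ((c == a) && (d == b))%:R).

Lemma GunitE (a b c d : 'I_r) : (a <= b)%N ->
  utval (Gunit a b) c d = ((c == a) && (d == b))%:R.
Proof.
move=> le_ab; rewrite mxE; case: ifP => // nle_cd.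
by case: eqP => // ca; case: eqP => // db; rewrite ca db le_ab in nle_cd.
Qed.

Lemma utval_sum (I : Type) (s : seq I) (P : pred I) (F : I -> utmx r) :
  utval (\sum_(i <- s | P i) F i) = \sum_(i <- s | P i) utval (F i).
Proof. exact: (raddf_sum (val : utmx r -> 'M[int]_r)). Qed.

Lemma utvalMz (x : utmx r) (n : int) c d :
  utval (x *~ n) c d = utval x c d * n.
Proof.
have utvalMn k : utval (x *+ k) c d = utval x c d *+ k.
  by elim: k => [|k IHk]; rewrite ?mxE // !mulrS mxE IHk.
by case: n => n; rewrite ?NegzE ?mulrNz ?mxE -pmulrn utvalMn -mulr_natr ?mulrN natz.
Qed.

Lemma utval_lower (g : utmx r) (a b : 'I_r) : (b < a)%N -> utval g a b = 0.
Proof. by move: (utvalP g) => /'forall_forallP/(_ a b)/implyP gU /gU/eqP. Qed.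

Lemma utmx_decomp (g : utmx r) :
  g = \sum_(a < r) \sum_(b < r | (a <= b)%N) Gunit a b *~ utval g a b.
Proof.
apply/val_inj/matrixP => c d /=; rewrite utval_sum summxE (bigD1 c) //=.
rewrite [X in _ + X]big1 ?addr0 => [|a ne_ac]; last first.
  rewrite utval_sum summxE big1 // => b le_ab.
  by rewrite utvalMz GunitE // eq_sym (negbTE ne_ac) mul0r.
rewrite utval_sum summxE; have [le_cd|lt_dc] := leqP c d; last first.
  rewrite utval_lower // big1 // => b le_cb; rewrite utvalMz GunitE //.
  case: (d =P b) => [db|_]; last by rewrite andbF mul0r.
  by rewrite db ltnNge le_cb in lt_dc.
rewrite (bigD1 d) //= big1 ?addr0 => [|b /andP[le_cb ne_bd]].
  by rewrite utvalMz GunitE // !eqxx mul1r.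
by rewrite utvalMz GunitE // andbC eq_sym (negbTE ne_bd) mul0r.
Qed.

Lemma utmx_additive_ext (U : zmodType) (F F' : {additive utmx r -> U}) :
    (forall a b : 'I_r, (a <= b)%N -> F (Gunit a b) = F' (Gunit a b)) ->
  F =1 F'.
Proof.
move=> eqF g; rewrite (utmx_decomp g) !raddf_sum; apply: eq_bigr => a _.
by rewrite !raddf_sum; apply: eq_bigr => b le_ab; rewrite !raddfMz eqF.
Qed.

End UpperUnits.

Section Classes.
Variable R : realType.
Local Notation C := R[i].
Variable r : nat.
Implicit Types A B D : Talg r.

Lemma partial_isometry_delta n i j : partial_isometry (delta_mx i j : 'M[C]_n).
Proof. by rewrite /partial_isometry adjmx_delta !mul_delta_mx. Qed.

Lemma blk_munit A a : blk A (tagnat.Rank a (Ordinal (bdim_gt0 A a))) = a.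
Proof. exact: tagnat.Rank1K. Qed.

Lemma talg_munit A (a b : 'I_r) : (a <= b)%N -> talg R A (munit R A a b).
Proof. by move=> le_ab; apply: talg_delta; rewrite !blk_munit. Qed.

Lemma bproj_amp A B (I : finType) (V : I -> 'M[C]_(tdim B, tdim A)) f J X c d :
    (forall i, blockwise (V i) (f i)) ->
  bproj R B c *m amp V J X *m bproj R B d =
  \sum_(i | J i) V i *m (selmx R (fun s => f i (blk A s) == c) *m X *m
     selmx R (fun s => f i (blk A s) == d)) *m adjmx (V i).
Proof.
move=> Vf; rewrite mulmx_sumr mulmx_suml; apply: eq_bigr => i _.
rewrite !mulmxA (blockwise_bproj _ (Vf i)) -!mulmxA.
by rewrite (blockwise_adj_bproj _ (Vf i)).
Qed.

Variables (A B : Talg r) (phi : 'M[C]_(tdim A) -> 'M[C]_(tdim B)).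
Variables (I : finType) (V : I -> 'M[C]_(tdim B, tdim A)).
Variable f : I -> {ffun 'I_r -> 'I_r}.
Hypothesis phiVf : spatial phi V f.

(** Compressing to block [(c, d)] keeps exactly the summands with [f i a = c] and [f i b = d], each
    contributing rank one. *)
Lemma cls_spatial (a b : 'I_r) : (a <= b)%N ->
  cls (phi (munit R A a b)) = \sum_i Gunit (f i a) (f i b).
Proof.
move=> le_ab; have [f_mono VV Vf phiE] := phiVf.
apply/val_inj/matrixP => c d; rewrite /= utval_sum summxE mxE.
rewrite (eq_bigr (fun i => ((c == f i a) && (d == f i b))%:R)); last first.
  by move=> i _; rewrite GunitE //; apply: f_mono.
pose J := [pred i | (c == f i a) && (d == f i b)].
have -> : \sum_i ((c == f i a) && (d == f i b))%:R = #|J|%:Z.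
  by rewrite -natr_sum natz -sum1_card [in RHS]big_mkcond; congr (Posz _).
case: ifP => [_|/negbT nle_cd]; last first.
  rewrite eq_card0 // => i; rewrite inE; apply/negP => /andP[/eqP ca /eqP db].
  by rewrite ca db f_mono in nle_cd.
have -> : phi (munit R A a b) = amp V predT (munit R A a b).
  exact/phiE/talg_munit.
rewrite (bproj_amp _ _ _ _ Vf).
congr (Posz _).
rewrite [X in \rank X](_ : _ = amp V J (munit R A a b)); last first.
  rewrite /amp [RHS]big_mkcond; apply: eq_bigr => i _ /=.
  set X := selmx _ _ *m _ *m _.
  have -> : X = if (c == f i a) && (d == f i b) then munit R A a b else 0.
    apply/matrixP => s t; rewrite selmx_mulr selmx_mull.
    case: ifP; rewrite !mxE.
      case/andP => /eqP -> /eqP ->; case: eqP => [->|_]; last by rewrite !mul0rn.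
      by case: eqP => [->|_]; rewrite ?mul0rn // !blk_munit !eqxx.
    case: (s =P _) => [->|_]; last by rewrite !mul0rn.
    case: (t =P _) => [->|_]; last by rewrite !mul0rn.
    rewrite !blk_munit (eq_sym (f i a)) (eq_sym (f i b)).
    by case: (c == _); case: (d == _).
  by case: ifP; rewrite ?mulmx0 ?mul0mx.
rewrite amp_rank // ?mxrank_delta ?mul1n; first by apply: eq_card => i; rewrite
  !inE.
exact: partial_isometry_delta.
Qed.

Lemma Gmap_Gunit (psi : 'M[C]_(tdim A) -> 'M[C]_(tdim B)) (a b : 'I_r) :
  (a <= b)%N -> Gmap psi (Gunit a b) = cls (psi (munit R A a b)).
Proof.
move=> le_ab; rewrite /Gmap (bigD1 a) //= [X in _ + X]big1 ?addr0.
  rewrite (bigD1 b) //= big1 ?addr0 => [|b' /andP[_ ne_b]].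
    by rewrite GunitE // !eqxx mulr1z.
  by rewrite GunitE // eqxx (negbTE ne_b) mulr0z.
move=> a' ne_a; rewrite big1 // => b' _.
by rewrite GunitE // (negbTE ne_a) mulr0z.
Qed.

Lemma Gmap_spatial (a b : 'I_r) : (a <= b)%N ->
  Gmap phi (Gunit a b) = \sum_i Gunit (f i a) (f i b).
Proof. by move=> le_ab; rewrite Gmap_Gunit // cls_spatial. Qed.

Lemma spatial_talg X : talg R A X -> talg R B (phi X).
Proof.
have [f_mono _ Vf phiE] := phiVf; move=> AX; rewrite phiE //.
apply/talgP => s t lt_ts; rewrite summxE big1 // => i _.
by move: s t lt_ts; apply/talgP/(blockwise_conj_talg (Vf i)).
Qed.

End Classes.

(** * Composition of regular maps and functoriality of [Gmap] *)

Section Composition.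
Variable R : realType.
Local Notation C := R[i].
Variable r : nat.
Variables (A B D : Talg r) (phi : 'M[C]_(tdim A) -> 'M[C]_(tdim B)).
Variable psi : 'M[C]_(tdim B) -> 'M[C]_(tdim D).

Lemma spatial_comp (I J : finType) (V : I -> 'M[C]_(tdim B, tdim A)) f
    (W : J -> 'M[C]_(tdim D, tdim B)) g :
    spatial phi V f -> spatial psi W g ->
  spatial (psi \o phi) (fun k : J * I => W k.1 *m V k.2)
    (fun k => [ffun a => g k.1 (f k.2 a)]).
Proof.
move=> phiVf psiWg; have [f_mono VV Vf phiE] := phiVf.
have [g_mono WW Wg psiE] := psiWg; split=> [k a b le_ab|[j i] [j' i']|k x s|X AX].
- by rewrite !ffunE; apply/g_mono/f_mono.
- rewrite adjmxM mulmxA -(mulmxA _ _ (W j')) WW /= xpair_eqE.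
  case: (j == j'); last by rewrite /= !raddf0 ?mulmx0 ?mul0mx.
  by rewrite mulmx1 VV.
(* A nonzero entry of the product passes through some coordinate [y] of [B], whose block links the
   two block maps. *)
- rewrite mxE => WV0; have /existsP[y] : [exists y, W k.1 x y * V k.2 y s != 0].
    apply: contraNT WV0; rewrite negb_exists => /forallP WV0.
    by rewrite big1 // => y _; apply/eqP/negPn/WV0.
  rewrite mulf_eq0 negb_or ffunE => /andP[/Wg-> /Vf->]; by [].
- rewrite /= psiE; last exact: (spatial_talg phiVf AX).
  transitivity (\sum_j \sum_i W j *m V i *m X *m adjmx (W j *m V i)).
    apply: eq_bigr => j _; rewrite phiE // mulmx_sumr mulmx_suml.
    by apply: eq_bigr => i _; rewrite adjmxM !mulmxA.
  by rewrite pair_bigA.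
Qed.

Hypothesis r_gt0 : (0 < r)%N.

Lemma regularE (A' B' : Talg r) (chi : 'M[C]_(tdim A') -> 'M[C]_(tdim B')) :
  regular chi -> exists (N : nat) (V : 'I_N -> 'M[C]_(tdim B', tdim A')) f,
    spatial chi V f.
Proof. exact: regular_spatial (Ordinal r_gt0). Qed.

Lemma regular_comp : regular phi -> regular psi -> regular (psi \o phi).
Proof.
move=> /regularE[N [V [f Vf]]] /regularE[M [W [g Wg]]].
exact: spatial_regular (spatial_comp Vf Wg).
Qed.

Lemma Gmap_comp x : regular phi -> regular psi ->
  Gmap (psi \o phi) x = Gmap psi (Gmap phi x).
Proof.
move=> /regularE[N [V [f Vf]]] /regularE[M [W [g Wg]]].
apply: (@utmx_additive_ext _ _ (Gmap (psi \o phi)) (Gmap psi \o Gmap phi)) =>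
  {x} a b le_ab.
have [f_mono _ _ _] := Vf.
rewrite /= (Gmap_spatial (spatial_comp Vf Wg)) // (Gmap_spatial Vf) // raddf_sum.
under [RHS]eq_bigr => i _ do rewrite /= (Gmap_spatial Wg) ?f_mono //.
rewrite exchange_big pair_bigA; apply: eq_bigr => -[j i] _.
by rewrite !ffunE.
Qed.

End Composition.

(** * Existence and uniqueness of regular maps *)

Section Existence.
Variable R : realType.
Local Notation C := R[i].
Variable r : nat.
Variables A B : Talg r.

Lemma card_blk_pred (u : pred 'I_r) :
  #|[pred s | u (blk A s)]| = (\sum_(a | u a) bdim A a)%N.
Proof.
rewrite -sum1_card (partition_big (blk A) u) //=; apply: eq_bigr => a ua.
rewrite -card_blk -sum1_card; apply: eq_bigl => s; rewrite !inE.
by case: eqP => [->|]; rewrite ?ua ?andbT ?andbF.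
Qed.

(** The second hypothesis says that block [c] of [B] has room for all blocks sent there, so the
    pairs [(i, s)] embed into the coordinates of [B] with the right blocks. The isometries are the
    0-1 matrices of this embedding. *)
Lemma spatial_exists (I : finType) (f : I -> {ffun 'I_r -> 'I_r}) :
    (forall i, {homo f i : a b / (a <= b)%N}) ->
    (forall c, \sum_i \sum_(a | f i a == c) bdim A a <= bdim B c)%N ->
  exists (phi : 'M[C]_(tdim A) -> 'M[C]_(tdim B)) V, spatial phi V f.
Proof.
move=> f_mono f_fit.
have [|h [h_inj h_blk]] := @fiber_injection (I * 'I_(tdim A))%type 'I_(tdim B)
    _ (fun x => f x.1 (blk A x.2)) (blk B).
  move=> c; rewrite card_blk; apply: leq_trans (f_fit c).
  rewrite -sum1_card (eq_bigl (fun x => xpredT x.1 && (f x.1 (blk A x.2) == c))) //.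
  rewrite -(pair_big_dep xpredT (fun i s => f i (blk A s) == c) (fun _ _ => 1%N)).
  apply: leq_sum => i _; rewrite -(card_blk_pred (fun a => f i a == c)).
  by rewrite -sum1_card.
pose V i : 'M[C]_(tdim B, tdim A) := \matrix_(j, s) (j == h (i, s))%:R.
exists (fun X => \sum_i V i *m X *m adjmx (V i)), V; split=> // [i j|i j s].
  apply/matrixP => s t; rewrite mxE (bigD1 (h (i, s))) //= big1 => [|k ne_k].
    rewrite !mxE eqxx conjC1 mul1r addr0 (inj_eq h_inj) xpair_eqE.
    by case: (i == j); case: (s == t).
  by rewrite !mxE (negbTE ne_k) conjC0 mul0r.
rewrite mxE pnatr_eq0 eqb0 negbK => /eqP ->.
exact: h_blk.
Qed.

End Existence.

(** * Uniqueness of spatial maps up to block diagonal unitaries *)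

Section Uniqueness.
Variable R : realType.
Local Notation C := R[i].
Variable r : nat.
Variables A B : Talg r.

Section Defect.
Variables (I : finType) (V : I -> 'M[C]_(tdim B, tdim A)).
Variable f : I -> {ffun 'I_r -> 'I_r}.
Hypothesis VV : forall i j, adjmx (V i) *m V j = (i == j)%:R%:M.
Hypothesis Vf : forall i, blockwise (V i) (f i).

Let Q := amp V predT 1%:M.

(** [Q] projects onto the sum of the ranges of the [V i]; this is the projection onto the part of
    block [c] left free by them. *)
Definition defect c := bproj R B c *m (1%:M - Q).

Lemma bproj_ampC c : bproj R B c *m Q = Q *m bproj R B c.
Proof.
rewrite mulmx_sumr mulmx_suml; apply: eq_bigr => i _.
rewrite !mulmx1 -[in RHS]mulmxA (blockwise_adj_bproj _ (@Vf i)).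
by rewrite !mulmxA (blockwise_bproj _ (@Vf i)).
Qed.

Lemma defectE c : defect c = (1%:M - Q) *m bproj R B c.
Proof. by rewrite /defect mulmxBl mulmxBr mulmx1 mul1mx bproj_ampC. Qed.

Lemma proj_range : proj (1%:M - Q).
Proof.
have QQ : Q *m Q = Q by rewrite /Q ampM // mulmx1.
split; last by rewrite adjmxB adjmx1 /Q amp_adj adjmx1.
by rewrite mulmxBl mul1mx !mulmxBr mulmx1 QQ subrr subr0.
Qed.

Lemma bproj_defect c d :
  bproj R B c *m defect d = if c == d then defect d else 0.
Proof.
rewrite /defect mulmxA bproj_orth.
by case: eqP => [->|]; rewrite ?mul0mx.
Qed.

Lemma defect_bproj c d :
  defect c *m bproj R B d = if c == d then defect c else 0.
Proof.
rewrite defectE -mulmxA bproj_orth.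
by case: eqP => [->|]; rewrite ?mulmx0.
Qed.

Lemma defect_proj c : proj (defect c).
Proof.
have [QQ Qad] := proj_range; split.
  rewrite {1}defectE -mulmxA (mulmxA (bproj R B c)) bproj_orth eqxx.
  by rewrite -/(defect c) defectE mulmxA QQ.
by rewrite [in LHS]/defect adjmxM Qad (proj2 (selmx_proj R _)) defectE.
Qed.

Lemma defect_mul c i : defect c *m V i = 0.
Proof.
rewrite /defect -mulmxA mulmxBl mul1mx mulmx_suml (bigD1 i) //= big1 => [|j ne_ji].
  by rewrite mulmx1 addr0 -mulmxA VV eqxx mulmx1 subrr mulmx0.
by rewrite mulmx1 -mulmxA VV (negbTE ne_ji) raddf0 mulmx0.
Qed.

Lemma sum_defect : \sum_c defect c = 1%:M - Q.
Proof. by rewrite /defect -mulmx_suml sum_bproj mul1mx. Qed.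

(** The dimension left free in a block depends on [f] alone and not on [V]. *)
Lemma defect_tr c : \tr (defect c) =
  \tr (bproj R B c) - \sum_i \tr (selmx R (fun s : 'I_(tdim A) => f i (blk A s)
    == c)).
Proof.
rewrite /defect mulmxBr mulmx1 linearB /= mulmx_sumr; congr (_ - _).
rewrite (raddf_sum (mxtrace : {additive _ -> _})).
apply: eq_bigr => i _ /=.
rewrite mulmx1 mulmxA (blockwise_bproj _ (@Vf i)) mxtrace_mulC mulmxA.
by rewrite VV eqxx mul1mx.
Qed.

End Defect.

Lemma bproj_comm_blockwise (U : 'M[C]_(tdim B)) :
    (forall c, bproj R B c *m U = U *m bproj R B c) ->
  blockwise U [ffun a : 'I_r => a].
Proof.
move=> PU j s; rewrite ffunE.
have /matrixP/(_ j s) := PU (blk B j).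
rewrite bprojE selmx_mull selmx_mulr eqxx mulr1n => ->.
by case: (blk B s =P blk B j) => [->|_] //; rewrite mulr0n eqxx.
Qed.

(** Both families leave the same dimension free in every block of [B], so partial isometries join
    the free parts block by block and complete the map from [V i] to [V' i] to a unitary. *)
Lemma spatial_unitary (I : finType) (phi phi' : 'M[C]_(tdim A) -> 'M[C]_(tdim B))
    V V' (f : I -> {ffun 'I_r -> 'I_r}) :
    spatial phi V f -> spatial phi' V' f ->
  exists U : 'M[C]_(tdim B), [/\ adjmx U *m U = 1%:M,
    blockwise U [ffun a : 'I_r => a] &
    forall X, talg R A X -> phi' X = U *m phi X *m adjmx U].
Proof.
case=> f_mono VV Vf phiE [_ VV' Vf' phiE'].
have trE c : \tr (defect V c) = \tr (defect V' c).
  by rewrite (defect_tr VV Vf) (defect_tr VV' Vf').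
have /choice[Z ZP] c := proj_equiv (defect_proj VV Vf c) (defect_proj VV' Vf'
  c) (trE c).
have Zpi c : partial_isometry (Z c).
  by apply: partial_isometry_of_proj; rewrite (proj1 (ZP c)); apply: defect_proj.
have ZE c : Z c *m defect V c = Z c by rewrite -(proj1 (ZP c)) mulmxA Zpi.
have EZ c : defect V' c *m Z c = Z c by rewrite -(proj2 (ZP c)) Zpi.
have PZ c d : bproj R B c *m Z d = if c == d then Z d else 0.
  by rewrite -{1}EZ mulmxA bproj_defect; case: eqP; rewrite ?mul0mx ?EZ.
have ZP' c d : Z c *m bproj R B d = if c == d then Z c else 0.
  by rewrite -{1}ZE -mulmxA (defect_bproj Vf); case: eqP; rewrite ?mulmx0 ?ZE.
have ZV c i : Z c *m V i = 0 by rewrite -ZE -mulmxA (defect_mul VV) mulmx0.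
have V'Z c i : adjmx (V' i) *m Z c = 0.
  rewrite -EZ mulmxA -[X in adjmx _ *m X](proj2 (defect_proj VV' Vf' c)).
  by rewrite -adjmxM (defect_mul VV') adjmx0 mul0mx.
have ZZ c d : adjmx (Z c) *m Z d = if c == d then defect V c else 0.
  have -> : Z d = bproj R B d *m Z d by rewrite PZ eqxx.
  rewrite mulmxA -[bproj R B d](proj2 (selmx_proj R _)) -adjmxM PZ eq_sym.
  by case: eqP => [->|_]; rewrite ?(proj1 (ZP _)) // adjmx0 mul0mx.
pose W := \sum_i V' i *m adjmx (V i); pose Y := \sum_c Z c.
have WV i : W *m V i = V' i.
  rewrite mulmx_suml (bigD1 i) //= big1 => [|j ne_ji].
    by rewrite addr0 -mulmxA VV eqxx mulmx1.
  by rewrite -mulmxA VV (negbTE ne_ji) raddf0 mulmx0.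
have WY : adjmx W *m Y = 0.
  rewrite adjmx_sum mulmx_suml big1 // => i _; rewrite mulmx_sumr big1 // => c _.
  by rewrite adjmxM adjmxK -mulmxA V'Z mulmx0.
have WW : adjmx W *m W = amp V predT 1%:M.
  rewrite {2}/W mulmx_sumr; apply: eq_bigr => i _.
  rewrite mulmxA mulmx1; congr (_ *m _).
  rewrite adjmx_sum mulmx_suml (bigD1 i) //= big1 => [|j ne_ji].
    by rewrite addr0 adjmxM adjmxK -mulmxA VV' eqxx mulmx1.
  by rewrite adjmxM adjmxK -mulmxA VV' (negbTE ne_ji) raddf0 mulmx0.
have YY : adjmx Y *m Y = 1%:M - amp V predT 1%:M.
  rewrite -(sum_defect V) adjmx_sum mulmx_suml; apply: eq_bigr => c _.
  rewrite mulmx_sumr (bigD1 c) //= big1 => [|d ne_dc]; rewrite ZZ.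
    by rewrite eqxx addr0.
  by rewrite eq_sym (negbTE ne_dc).
(* W carries the range of V to the range of V'; Y does the same for their
   complements, block by block. *)
exists (W + Y); split=> [||X AX].
- have YW : adjmx Y *m W = 0 by rewrite -[LHS]adjmxK adjmxM adjmxK WY adjmx0.
  by rewrite adjmxD mulmxDl !mulmxDr WW WY YW YY addr0 add0r addrC subrK.
- apply: bproj_comm_blockwise => c; rewrite mulmxDl mulmxDr; congr (_ + _).
    rewrite mulmx_sumr mulmx_suml; apply: eq_bigr => i _.
    by rewrite mulmxA (blockwise_bproj _ (Vf' i)) -!mulmxA (blockwise_adj_bproj
      _ (Vf i)).
  rewrite mulmx_sumr mulmx_suml; apply: eq_bigr => d _.
  by rewrite PZ ZP' eq_sym.
rewrite phiE' // phiE // mulmx_sumr mulmx_suml; apply: eq_bigr => i _.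
have UV : (W + Y) *m V i = V' i.
  by rewrite mulmxDl WV mulmx_suml big1 ?addr0.
by rewrite -{1}UV -UV adjmxM !mulmxA.
Qed.

End Uniqueness.

(** * Families of monotone maps with equal pair counts *)

Section PairCounts.
Variables (r : nat) (I I' : finType).
Variables (f : I -> {ffun 'I_r -> 'I_r}) (f' : I' -> {ffun 'I_r -> 'I_r}).
Hypothesis f_mono : forall i, {homo f i : a b / (a <= b)%N}.
Hypothesis f'_mono : forall i, {homo f' i : a b / (a <= b)%N}.
Hypothesis eq_pairs : forall a b : 'I_r, (a <= b)%N ->
  \sum_i Gunit (f i a) (f i b) = \sum_i Gunit (f' i a) (f' i b).

Definition equidistributed (P : pred {ffun 'I_r -> 'I_r}) :=
  #|[pred i | P (f i)]| = #|[pred i | P (f' i)]|.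

Lemma equidistributed_ext P Q :
    (forall h : {ffun 'I_r -> 'I_r},
       {homo h : a b / (a <= b)%N} -> P h = Q h) ->
  equidistributed P -> equidistributed Q.
Proof.
move=> eqPQ; rewrite /equidistributed => eqP'.
transitivity #|[pred i | P (f i)]|; last rewrite eqP'.
  by apply: eq_card => i; rewrite !inE eqPQ.
by apply: eq_card => i; rewrite !inE eqPQ.
Qed.

(** On monotone maps [S] is the disjoint union of [P] and [Q], so the count of [Q] cancels. *)
Lemma equidistributed_diff (S P Q : pred {ffun 'I_r -> 'I_r}) :
    (forall h : {ffun 'I_r -> 'I_r}, {homo h : a b / (a <= b)%N} ->
       S h = P h || Q h) ->
    (forall h, P h -> Q h -> false) ->
  equidistributed S -> equidistributed Q -> equidistributed P.
Proof.
move=> SPQ PQ0 eqS eqQ; apply: (@addIn #|[pred i | Q (f i)]|).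
have split_card (J : finType) (g : J -> {ffun 'I_r -> 'I_r}) :
    (forall j, {homo g j : a b / (a <= b)%N}) ->
    (#|[pred j | P (g j)]| + #|[pred j | Q (g j)]| = #|[pred j | S (g j)]|)%N.
  move=> g_mono; rewrite -cardUI [X in (_ + X)%N]eq_card0 ?addn0.
    by apply: eq_card => j; rewrite !inE SPQ.
  by move=> j; rewrite !inE; apply/andP => -[/PQ0/[apply]].
by rewrite split_card // eqQ split_card.
Qed.

(** The entry at [(c, d)] of the sums in [eq_pairs] counts the maps taking [(a, b)] to [(c, d)];
    these entries are added over the pairs satisfying [p]. *)
Lemma equidistributed_pair (p : rel 'I_r) (a b : 'I_r) : (a <= b)%N ->
  equidistributed (fun h => p (h a) (h b)).
Proof.
move=> le_ab; have cardE (J : finType) (g : J -> {ffun 'I_r -> 'I_r}) :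
    (forall j, {homo g j : a b / (a <= b)%N}) ->
    #|[pred j | p (g j a) (g j b)]|%:Z =
    \sum_(k : 'I_r * 'I_r | p k.1 k.2) utval (\sum_j Gunit (g j a) (g j b)) k.1 k.2.
  move=> g_mono.
  rewrite (eq_bigr (fun k : 'I_r * 'I_r =>
      \sum_j (k == (g j a, g j b))%:R)) => [|k _]; last first.
    rewrite utval_sum summxE; apply: eq_bigr => j _.
    by rewrite GunitE ?g_mono // -pair_eqE.
  rewrite exchange_big /= -sum1_card -natz natr_sum big_mkcond /=.
  apply: eq_bigr => j _; rewrite inE -natr_sum.
  case: ifP => [pj|npj].
    rewrite (bigD1 (g j a, g j b)) //= eqxx big1 ?addn0 // => k /andP[_ ne_k].
    by rewrite (negbTE ne_k).
  rewrite big1 // => k pk; case: eqP => // ek.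
  by rewrite ek /= npj in pk.
by apply/eqP; rewrite -eqz_nat !cardE // eq_pairs.
Qed.

Lemma equidistributed_bij :
    (forall g : {ffun 'I_r -> 'I_r}, {homo g : a b / (a <= b)%N} ->
       equidistributed (pred1 g)) ->
  exists2 s : I -> I', bijective s & forall i, f' (s i) = f i.
Proof.
move=> eqd; have eq_card_fiber g :
    #|[pred i | f i == g]| = #|[pred i | f' i == g]|.
  (* A value taken by either family is monotone, so [eqd] applies; any other value has empty fibres
     on both sides. *)
  have [[i /eqP <-]|no_i] := pselect (exists i, f i == g); first exact: eqd.
  have [[i /eqP <-]|no_i'] := pselect (exists i, f' i == g); first exact: eqd.
  rewrite !eq_card0 // => i; rewrite inE; apply/negP => fi.
    by apply: no_i'; exists i.
  by apply: no_i; exists i.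
have [s [s_inj sE]] : exists h : I -> I', injective h /\ forall x, f' (h x) = f x.
  by apply: fiber_injection => g; rewrite eq_card_fiber.
have [t [t_inj _]] : exists h : I' -> I, injective h /\ forall x, f (h x) = f' x.
  by apply: fiber_injection => g; rewrite eq_card_fiber.
exists s => //; apply: inj_card_bij => //.
exact: leq_card t_inj.
Qed.

End PairCounts.

(* A monotone map h of {0,1,2} with h 1 = 0 has h 0 = 0, and dually for the
   value 2, so these maps are recognised from two of their values; those with
   h 1 = 1 make up the rest of the event fixing the values at 0 and 2. *)
Lemma equidistributed_point (r : nat) (hr : r = 2%N \/ r = 3%N) (I I' : finType)
    (f : I -> {ffun 'I_r -> 'I_r}) (f' : I' -> {ffun 'I_r -> 'I_r}) :
    (forall i, {homo f i : a b / (a <= b)%N}) ->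
    (forall i, {homo f' i : a b / (a <= b)%N}) ->
    (forall a b : 'I_r, (a <= b)%N ->
      \sum_i Gunit (f i a) (f i b) = \sum_i Gunit (f' i a) (f' i b)) ->
  forall g : {ffun 'I_r -> 'I_r}, {homo g : a b / (a <= b)%N} ->
  equidistributed f f' (pred1 g).
Proof.
case: hr f f' => -> f f' f_mono f'_mono eq_pairs g g_mono.
  (* For [r = 2] a map is the same as its pair of values. *)
  pose p x y := (x == g ord0) && (y == g ord_max).
  apply: equidistributed_ext (equidistributed_pair f_mono f'_mono eq_pairs p
    (leq0n _ : (ord0 <= ord_max)%N)) => // h _; rewrite /p /=.
  apply/andP/eqP => [[/eqP h0 /eqP h1]|-> //]; apply/ffunP => -[[|[|//]] lt_a].
    by rewrite (_ : Ordinal lt_a = ord0) //; apply: val_inj.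
  by rewrite (_ : Ordinal lt_a = ord_max) //; apply: val_inj.
pose o0 : 'I_3 := ord0; pose o1 : 'I_3 := inord 1; pose o2 : 'I_3 := ord_max.
have o1E : nat_of_ord o1 = 1%N by rewrite inordK.
have le01 : (o0 <= o1)%N by []. have le12 : (o1 <= o2)%N by rewrite o1E.
have oP (a : 'I_3) : [|| a == o0, a == o1 | a == o2].
  by rewrite -!val_eqE /= o1E; case: a => -[|[|[|]]].
pose E k (h : {ffun 'I_3 -> 'I_3}) := [&& h o0 == g o0, h o1 == k & h o2 == g o2].
have eqd_pair := equidistributed_pair f_mono f'_mono eq_pairs.
have eqd_ext := equidistributed_ext f_mono f'_mono.
have E0 : equidistributed f f' (E o0).
  (* Since [h o1 = o0] forces [h o0 = o0], the condition on [h o0] becomes the constant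
     [g o0 == o0]. *)
  pose p x y := [&& g o0 == o0, x == o0 & y == g o2].
  apply: eqd_ext (eqd_pair p o1 o2 le12) => h h_mono; rewrite /p /E.
  have [h1|_] := eqVneq (h o1) o0; last by rewrite !andbF.
  have -> : h o0 = o0.
    by have := h_mono _ _ le01; rewrite h1 leqn0 => /eqP h0; apply: val_inj.
  by rewrite [o0 == _]eq_sym.
have E2 : equidistributed f f' (E o2).
  pose p x y := [&& g o2 == o2, x == g o0 & y == o2].
  apply: eqd_ext (eqd_pair p o0 o1 le01) => h h_mono; rewrite /p /E.
  have [h1|_] := eqVneq (h o1) o2; last by rewrite !andbF.
  have -> : h o2 = o2.
    have := h_mono _ _ le12; rewrite h1 => le_h2.
    by apply/val_inj/eqP; rewrite eqn_leq -ltnS ltn_ord.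
  by rewrite [o2 == _]eq_sym andbT andbC.
have E1 : equidistributed f f' (E o1).
  pose p x y := (x == g o0) && (y == g o2).
  have eqd12 : equidistributed f f' (predU (E o1) (E o2)).
    apply: equidistributed_diff (eqd_pair p o0 o2 isT) E0 => //= h => [_|].
      by rewrite /p /E; case/or3P: (oP (h o1)) => /eqP ->;
        case: (h o0 == _); case: (h o2 == _); rewrite /= ?eqxx ?andbF ?orbT.
    case/orP => /and3P[_ /eqP h1 _] /and3P[_ /eqP];
      by rewrite h1 => /(congr1 (@nat_of_ord _)); rewrite /= ?o1E.
  apply: equidistributed_diff eqd12 E2 => // h.
  case/and3P=> _ /eqP h1 _ /and3P[_ /eqP].
  by rewrite h1 => /(congr1 (@nat_of_ord _)); rewrite /= o1E.
have eqdE k : equidistributed f f' (E k).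
  by case/or3P: (oP k) => /eqP ->.
apply: eqd_ext (eqdE (g o1)) => h _; rewrite /E.
apply/and3P/eqP => [[/eqP h0 /eqP h1 /eqP h2]|->]; last by rewrite !eqxx.
by apply/ffunP => a; case/or3P: (oP a) => /eqP ->.
Qed.

(** * The scale *)

Section Scale.
Variable R : realType.
Local Notation C := R[i].
Variable r : nat.
Implicit Types A B : Talg r.

(** An explicit form of the scale, equal to it by [scaleE], that can be followed through regular
    maps without masas. *)
Definition fits A (g : utmx r) : Prop :=
  [/\ forall a b, 0 <= utval g a b,
      forall a, \sum_b utval g a b <= (bdim A a)%:Z &
      forall b, \sum_a utval g a b <= (bdim A b)%:Z].

(** Adjoining the scalars to [D] gives an abelian star subalgebra, which maximality makes equal to
    [D]. *)
Lemma masa1 n (D : set 'M[C]_n) : masa D -> D 1%:M.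
Proof.
move=> [[[D0 DL DM Dad] DC] Dmax].
pose E : set 'M[C]_n := [set Y | exists (X : 'M[C]_n) (c : C), D X /\ Y = X + c%:M].
have DD X Y : D X -> D Y -> D (X + Y) by rewrite -{2}[X]scale1r; apply: DL.
have DZ c X : D X -> D (c *: X) by move=> DX; rewrite -[_ *: _]addr0; apply: DL.
have eD : E = D.
  apply: Dmax => [|X DX]; last by exists X, 0; rewrite raddf0 addr0.
  split=> [|_ _ [X [c [DX ->]]] [Y [d [DY ->]]]]; last first.
    rewrite !mulmxDl !mulmxDr !mul_mx_scalar !mul_scalar_mx !scale_scalar_mx.
    by rewrite (DC Y X) // addrACA [d * c]mulrC -[RHS]addrACA addrACA.
  split=> [|c _ _ [X [d [DX ->]]] [Y [e [DY ->]]]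
    |_ _ [X [c [DX ->]]] [Y [d [DY ->]]]|_ [X [c [DX ->]]]].
  - by exists 0, 0; rewrite raddf0 addr0.
  - exists (c *: X + Y), (c * d + e); split; first exact: DL.
    by rewrite scalerDr scale_scalar_mx raddfD addrACA.
  - exists (X *m Y + (d *: X + c *: Y)), (c * d); split.
      by apply: (DD _ _ (DM _ _ DX DY)); apply: DD; apply: DZ.
    rewrite mulmxDl !mulmxDr mul_mx_scalar !mul_scalar_mx scale_scalar_mx.
    by rewrite !addrA.
  - exists (adjmx X), c^*; split; first exact: Dad.
    by rewrite adjmxD; congr (_ + _); rewrite /adjmx tr_scalar_mx map_scalar_mx.
by rewrite -eD; exists 0, 1; rewrite add0r.
Qed.

(** The matrices [X Q + Z (1 - Q)] with [X], [Z] in [D] form an abelian star subalgebra because [Q]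
    commutes with [D]. It contains [D] and [Q], so maximality applies. *)
Lemma masa_proj n (D : set 'M[C]_n) (Q : 'M[C]_n) : masa D -> proj Q ->
  (forall X, D X -> Q *m X = X *m Q) -> D Q.
Proof.
move=> mD [QQ Qad] QC; have D1 := masa1 mD.
case: mD => [[[D0 DL DM Dad] DC] Dmax].
pose Q' := 1%:M - Q.
have Q'C X : D X -> Q' *m X = X *m Q'.
  by move=> DX; rewrite mulmxBl mulmxBr mul1mx mulmx1 QC.
have QQ' : Q *m Q' = 0 by rewrite mulmxBr mulmx1 QQ subrr.
have Q'Q : Q' *m Q = 0 by rewrite mulmxBl mul1mx QQ subrr.
have Q'Q' : Q' *m Q' = Q' by rewrite {2}/Q' mulmxBr mulmx1 Q'Q subr0.
have Q'ad : adjmx Q' = Q' by rewrite adjmxB adjmx1 Qad.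
have QsQ' : Q + Q' = 1%:M by rewrite addrC subrK.
clearbody Q'; pose e X Z : 'M[C]_n := X *m Q + Z *m Q'.
have eM X Z X' Z' : D X' -> D Z' -> e X Z *m e X' Z' = e (X *m X') (Z *m Z').
  move=> DX' DZ'; rewrite /e mulmxDl !mulmxDr.
  rewrite -!mulmxA !(mulmxA Q) !(mulmxA Q') !QC // !Q'C //.
  by rewrite -!(mulmxA _ Q) -!(mulmxA _ Q') QQ QQ' Q'Q Q'Q' !mulmx0 addr0 add0r.
pose E : set 'M[C]_n := [set Y | exists X Z, [/\ D X, D Z & Y = e X Z]].
have eD : E = D.
  apply: Dmax => [|X DX]; last first.
    by exists X, X; rewrite /e -mulmxDr QsQ' mulmx1.
  split=> [|_ _ [X [Z [DX DZ ->]]] [X' [Z' [DX' DZ' ->]]]]; last first.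
    by rewrite !eM // (DC X) // (DC Z).
  split=> [|c _ _ [X [Z [DX DZ ->]]] [X' [Z' [DX' DZ' ->]]]
    |_ _ [X [Z [DX DZ ->]]] [X' [Z' [DX' DZ' ->]]]|_ [X [Z [DX DZ ->]]]].
  - by exists 0, 0; rewrite /e !mul0mx addr0.
  - exists (c *: X + X'), (c *: Z + Z'); split; try exact: DL.
    by rewrite /e scalerDr !mulmxDl -!scalemxAl addrACA.
  - by exists (X *m X'), (Z *m Z'); split; [exact: DM|exact: DM|exact: eM].
  - exists (adjmx X), (adjmx Z); split; try exact: Dad.
    by rewrite /e adjmxD !adjmxM Qad Q'ad QC ?Q'C //; apply: Dad.
by rewrite -eD; exists 1%:M, 0; rewrite /e mul1mx mul0mx addr0.
Qed.

Lemma mxrank_adj m n (X : 'M[C]_(m, n)) : \rank (adjmx X) = \rank X.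
Proof. by rewrite mxrank_map mxrank_tr. Qed.

Lemma bproj_proj A a : proj (bproj R A a).
Proof. exact: selmx_proj. Qed.

Lemma rank_bproj A a : \rank (bproj R A a) = bdim A a.
Proof.
apply/eqP; rewrite -(eqr_nat C) (proj_rank (bproj_proj A a)) selmx_tr.
by rewrite card_blk.
Qed.

Lemma talg_bprojC A X a : talg R A X -> talg R A (adjmx X) ->
  bproj R A a *m X = X *m bproj R A a.
Proof.
move=> /talgP AX /talgP AX'; apply/matrixP => s t.
rewrite !bprojE selmx_mull selmx_mulr.
have [->|st] := eqVneq (blk A s) (blk A t); first by [].
suff -> : X s t = 0 by rewrite !mul0rn.
move: st; rewrite -val_eqE neq_ltn => /orP[lt_st|]; last exact: AX.
have /eqP := AX' t s lt_st; rewrite adjmxE conjC_eq0 => /eqP.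
by [].
Qed.

(** [D] is closed under adjoints and lies in the triangular algebra, so its elements are block
    diagonal and commute with the block projections. *)
Lemma masa_bproj A (D : set 'M[C]_(tdim A)) a :
  masa D -> D `<=` talg R A -> D (bproj R A a).
Proof.
move=> mD DA; apply: masa_proj (bproj_proj A a) _ => // X DX.
apply: talg_bprojC; apply: DA => //.
by case: mD => [[[_ _ _ +] _] _]; apply.
Qed.

(** The matrices [v P_b v^*], [v^* v] and [v v^*] lie in [D] and so commute with the block
    projections. Hence the compressions [P_a v P_b] are partial isometries, and their ranks, being
    traces, add up to the rank of [P_a v]. *)
Lemma masa_row_rank A (D : set 'M[C]_(tdim A)) (v : 'M[C]_(tdim A)) a :
    masa D -> D `<=` talg R A -> normalises v D -> partial_isometry v ->
  (\sum_b \rank (bproj R A a *m v *m bproj R A b) <= bdim A a)%N.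
Proof.
move=> mD DA vD pv; pose P := bproj R A.
have DP b : D (P b) by apply: masa_bproj.
have DC X Y : D X -> D Y -> X *m Y = Y *m X.
  by case: mD => [[_ +] _]; apply.
have D1 := masa1 mD.
have [Dv'v Dvv'] : D (adjmx v *m v) /\ D (v *m adjmx v).
  by have [] := vD _ D1; rewrite !mulmx1.
have PP b : P b *m P b = P b by case: (bproj_proj A b).
have Pad b : adjmx (P b) = P b by case: (bproj_proj A b).
have pPv : partial_isometry (P a *m v).
  rewrite /partial_isometry adjmxM Pad.
  have -> : P a *m v *m (adjmx v *m P a) *m (P a *m v) =
      P a *m (v *m adjmx v *m (P a *m P a)) *m v by rewrite !mulmxA.
  by rewrite PP (DC _ _ Dvv') // mulmxA PP -mulmxA pv.
have pPvP b : partial_isometry (P a *m v *m P b).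
  rewrite /partial_isometry !adjmxM !Pad.
  have DvPv : D (v *m P b *m adjmx v) by case: (vD _ (DP b)).
  have -> : P a *m v *m P b *m (P b *m (adjmx v *m P a)) *m (P a *m v *m P b) =
      P a *m (v *m (P b *m P b) *m adjmx v *m (P a *m P a)) *m v *m P b.
    by rewrite !mulmxA.
  rewrite !PP (DC _ _ DvPv) // mulmxA PP.
  have -> : P a *m (v *m P b *m adjmx v) *m v *m P b =
      P a *m v *m (P b *m (adjmx v *m v)) *m P b by rewrite !mulmxA.
  rewrite (DC (P b)) //.
  have -> : P a *m v *m (adjmx v *m v *m P b) *m P b =
      P a *m (v *m adjmx v *m v) *m (P b *m P b) by rewrite !mulmxA.
  by rewrite pv PP.
have -> : (\sum_b \rank (P a *m v *m P b) = \rank (P a *m v))%N.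
  apply/eqP; rewrite -(eqr_nat C) natr_sum partial_isometry_rank //.
  rewrite -[X in \tr (_ *m X)]mulmx1 -(sum_bproj R A) mulmx_sumr mulmx_sumr.
  rewrite raddf_sum; apply/eqP; apply: eq_bigr => b _ /=.
  rewrite partial_isometry_rank // adjmxM Pad -mulmxA mxtrace_mulC.
  by rewrite -!mulmxA PP.
by rewrite -[X in (_ <= X)%N]rank_bproj mxrankM_maxl.
Qed.

Lemma scale_fits A (g : utmx r) : scale R A g -> fits A g.
Proof.
move=> [v [Av pv Av'v Avv' [D [mD DA vD]]] <-].
have le_rank a b : utval (cls v) a b <= (\rank (bproj R A a *m v *m bproj R A
  b))%:Z.
  by rewrite mxE; case: ifP.
split=> [a b|a|b]; first by rewrite mxE; case: ifP.
  apply: le_trans (_ : (\sum_b \rank (bproj R A a *m v *m bproj R A b))%:Z <= _).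
    by rewrite -natz natr_sum; apply: ler_sum => b _; rewrite natz.
  by rewrite lez_nat (masa_row_rank a mD DA vD pv).
(* Column sums for [v] are row sums for [adjmx v], which also normalises [D]. *)
apply: le_trans (_ : (\sum_a \rank (bproj R A b *m adjmx v *m bproj R A a))%:Z
  <= _).
  rewrite -natz natr_sum; apply: ler_sum => a _; rewrite natz.
  rewrite -mxrank_adj !adjmxM adjmxK !(proj2 (bproj_proj A _)) mulmxA.
  exact: le_rank.
rewrite lez_nat; apply: (masa_row_rank b mD DA).
  by move=> X DX; rewrite adjmxK; case: (vD X DX).
have := congr1 (@adjmx R _ _) pv; rewrite !adjmxM /partial_isometry.
by rewrite mulmxA.
Qed.

(** A matrix commuting with every diagonal matrix unit is diagonal, as comparing entries at [(s, t)]
    shows. *)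
Lemma diag_masa n : masa [set X : 'M[C]_n | is_diag_mx X].
Proof.
have diagP (X : 'M[C]_n) : is_diag_mx X -> exists d, X = diag_mx d.
  by move/diag_mxP.
have diagI (X : 'M[C]_n) : (forall i j, i != j -> X i j = 0) -> is_diag_mx X.
  by move=> X0; apply/is_diag_mxP => i j; rewrite val_eqE => /X0.
split.
  split; last first.
    by move=> _ _ /= /diagP[d ->] /diagP[e ->]; rewrite diag_mxC.
  split=> /= [|c _ _ /diagP[d ->] /diagP[e ->]|_ _ /diagP[d ->] /diagP[e ->]
    |_ /diagP[d ->]].
  - exact: mx0_is_diag.
  - by rewrite -linearZ -raddfD diag_mx_is_diag.
  - rewrite mul_diag_mx; apply/diagI => i j ne_ij.
    by rewrite !mxE (negbTE ne_ij) mulr0n mulr0.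
  - apply/diagI => i j ne_ij.
    by rewrite !mxE eq_sym (negbTE ne_ij) mulr0n conjC0.
move=> E [_ EC] DE; apply/seteqP; split=> // Y EY; apply/diagI => s t ne_st.
have Es : E (delta_mx s s).
  apply/DE/diagI => i j ne_ij; rewrite mxE.
  case: (i =P s) => //= is_; case: (j =P s) => //= js.
  by rewrite is_ js eqxx in ne_ij.
have /matrixP/(_ s t) := EC _ _ Es EY.
rewrite !mxE (bigD1 s) //= big1 => [|k ne_k]; last first.
  by rewrite mxE (negbTE ne_k) andbF mul0r.
rewrite mxE !eqxx mul1r addr0 => ->; rewrite big1 // => k _.
by rewrite !mxE [t == s]eq_sym (negbTE ne_st) andbF mulr0.
Qed.

End Scale.

(** * Realising classes by partial permutations, and the scale under regular maps *)

Section ScaleConverse.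
Variable R : realType.
Local Notation C := R[i].
Variable r : nat.
Implicit Types A B : Talg r.

Section PartialPermutation.
Variables (n : nat) (X : finType) (rho kappa : X -> 'I_n).
Hypotheses (rho_inj : injective rho) (kappa_inj : injective kappa).

Definition pperm_mx (J : pred X) : 'M[C]_n :=
  \sum_(x | J x) delta_mx (rho x) (kappa x).

Lemma adj_pperm_mx J :
  adjmx (pperm_mx J) = \sum_(x | J x) delta_mx (kappa x) (rho x).
Proof. by rewrite adjmx_sum; apply: eq_bigr => x _; rewrite adjmx_delta. Qed.

Lemma pperm_mx_adj J :
  adjmx (pperm_mx J) *m pperm_mx J = \sum_(x | J x) delta_mx (kappa x) (kappa x).
Proof.
rewrite adj_pperm_mx mulmx_suml; apply: eq_bigr => x Jx.
rewrite mulmx_sumr (bigD1 x) //= mul_delta_mx big1 ?addr0 // => y /andP[_ ne_yx].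
by rewrite mul_delta_mx_0 // (inj_eq rho_inj) eq_sym.
Qed.

Lemma pperm_mx_partial_isometry J : partial_isometry (pperm_mx J).
Proof.
rewrite /partial_isometry -mulmxA pperm_mx_adj mulmx_suml.
apply: eq_bigr => x Jx; rewrite mulmx_sumr (bigD1 x) //= mul_delta_mx.
rewrite big1 ?addr0 // => y /andP[_ ne_yx].
by rewrite mul_delta_mx_0 // (inj_eq kappa_inj) eq_sym.
Qed.

Lemma pperm_mx_rank J : \rank (pperm_mx J) = #|J|.
Proof.
apply/eqP; rewrite -(eqr_nat C) partial_isometry_rank; last first.
  exact: pperm_mx_partial_isometry.
rewrite pperm_mx_adj (raddf_sum (mxtrace : {additive _ -> _})) -sum1_card natr_sum.
apply/eqP; apply: eq_bigr => x _ /=.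
by rewrite -(mul_delta_mx (0 : 'I_1)) mxtrace_mulC mul_delta_mx trace_mx11 mxE
  !eqxx.
Qed.

(** A nonzero entry at [(rho x, rho y)] requires [kappa x = kappa y], hence [x = y]: partial
    permutations normalise the diagonal masa. *)
Lemma pperm_mx_conj_diag J d : is_diag_mx (pperm_mx J *m diag_mx d *m adjmx
  (pperm_mx J)).
Proof.
apply/is_diag_mxP => i j ne_ij; rewrite adj_pperm_mx !mulmx_suml summxE big1 //
  => x _.
rewrite mulmx_sumr summxE big1 // => y _.
rewrite -(mul_delta_mx (0 : 'I_1)) -mulmxA -mulmxA mxE big_ord1 mxE.
case: eqP => [ix|_]; last by rewrite mul0r.
rewrite mul_diag_mx mxE big1 ?mulr0 // => k _.
rewrite !mxE; case: (k =P kappa x) => [->|_]; last by rewrite andbF mul0r.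
case: (j =P rho y) => [jy|_]; last by rewrite andbF mulr0 mulr0.
case: (kappa x =P kappa y) => [/kappa_inj xy|_]; last by rewrite mulr0 mulr0.
by rewrite ix jy xy eqxx in ne_ij.
Qed.

End PartialPermutation.

Lemma pperm_mx_adjE n (X : finType) (rho kappa : X -> 'I_n) J :
  adjmx (pperm_mx rho kappa J) = pperm_mx kappa rho J.
Proof. exact: adj_pperm_mx. Qed.

Lemma diag_talg A (d : 'rV[C]_(tdim A)) : talg R A (diag_mx d).
Proof.
apply/talgP => s t lt_ts; rewrite mxE; case: eqP => // st.
by rewrite st ltnn in lt_ts.
Qed.

(** Take [g a b] cells for each pair [(a, b)]. The row bounds embed the cells into coordinates by
    row block, the column bounds by column block, and the resulting partial permutation has class
    [g]. *)
Lemma fits_scale A (g : utmx r) : fits A g -> scale R A g.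
Proof.
case=> g_ge0 g_row g_col; pose n (p : 'I_r * 'I_r) := `|utval g p.1 p.2|%N.
have nE a b : (n (a, b))%:Z = utval g a b by rewrite /n /= gez0_abs.
pose X := {p : 'I_r * 'I_r & 'I_(n p)}.
have cardX (u : pred ('I_r * 'I_r)) : #|[pred x : X | u (tag x)]| = (\sum_(p |
  u p) n p)%N.
  transitivity (\sum_(p | u p) \sum_(k < n p) 1)%N.
    rewrite sig_big_dep -sum1_card; apply: eq_bigl => x.
    by rewrite inE andbT.
  by apply: eq_bigr => p _; rewrite sum1_card card_ord.
have [|rho [rho_inj rhoE]] := @fiber_injection X 'I_(tdim A) _
    (fun x => (tag x).1) (blk A).
  move=> a; rewrite card_blk (cardX (fun p => p.1 == a)) -lez_nat.
  apply: le_trans (g_row a); rewrite -natz natr_sum.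
  rewrite (eq_bigr (fun p => utval g p.1 p.2)) => [|[a' b] _]; last by rewrite
    natz nE.
  suff -> : \sum_(p : 'I_r * 'I_r | p.1 == a) utval g p.1 p.2 =
      \sum_(a' | a' == a) \sum_b utval g a' b by rewrite big_pred1_eq.
  by rewrite pair_big; apply: eq_bigl => p; rewrite andbT.
have [|kappa [kappa_inj kappaE]] := @fiber_injection X 'I_(tdim A) _
    (fun x => (tag x).2) (blk A).
  move=> b; rewrite card_blk (cardX (fun p => p.2 == b)) -lez_nat.
  apply: le_trans (g_col b); rewrite -natz natr_sum.
  rewrite (eq_bigr (fun p => utval g p.1 p.2)) => [|[a b'] _]; last by rewrite
    natz nE.
  suff -> : \sum_(p : 'I_r * 'I_r | p.2 == b) utval g p.1 p.2 =
      \sum_a \sum_(b' | b' == b) utval g a b'.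
    by apply: ler_sum => a _; rewrite big_pred1_eq.
  by rewrite pair_big.
pose v := pperm_mx rho kappa predT.
have diag_in (h h' : X -> 'I_(tdim A)) : injective h' ->
    talg R A (pperm_mx h h' predT *m adjmx (pperm_mx h h' predT)).
  move=> h'_inj; have := pperm_mx_conj_diag h h'_inj predT (const_mx 1).
  by rewrite diag_const_mx mulmx1 => /diag_mxP[d ->]; apply: diag_talg.
(* Entries of [g] below the diagonal vanish, so there are no cells there. *)
have Xle (x : X) : ((tag x).1 <= (tag x).2)%N.
  case: x => [[a b] k] /=; case: leqP => // lt_ba.
  by move: k; rewrite /n /= utval_lower // => -[].
exists v; last first.
  apply/val_inj/matrixP => a b; rewrite mxE.
  case: ifP => [le_ab|nle_ab]; last by rewrite utval_lower // ltnNge nle_ab.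
  pose J := [pred x : X | tag x == (a, b)].
  rewrite [X in \rank X](_ : _ = pperm_mx rho kappa J); last first.
    rewrite mulmx_sumr mulmx_suml [RHS]big_mkcond; apply: eq_bigr => x _.
    apply/matrixP => s t; rewrite !bprojE selmx_mulr selmx_mull mxE.
    rewrite /J inE -pair_eqE /= -rhoE -kappaE.
    case: ifP => [|]; rewrite mxE.
      case: (s =P _) => [->|_] /=; last by rewrite !mul0rn.
      case: (t =P _) => [->|_] /=; last by rewrite !mul0rn.
      by case/andP=> -> ->.
    case: (s =P _) => [->|_] /=; last by rewrite !mul0rn.
    case: (t =P _) => [->|_] /=; last by rewrite !mul0rn.
    by case: eqP; case: eqP.
  rewrite pperm_mx_rank // -nE (cardX (pred1 (a, b))).
  by rewrite big_pred1_eq.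
split.
- apply/talgP => s t lt_ts; rewrite summxE big1 // => x _; rewrite mxE.
  case: (s =P _) => //= sx; case: (t =P _) => //= tx.
  by move: lt_ts; rewrite sx tx rhoE kappaE ltnNge Xle.
- exact: pperm_mx_partial_isometry.
- by have := diag_in kappa rho rho_inj; rewrite !pperm_mx_adjE.
- exact: diag_in rho kappa kappa_inj.
exists [set X | is_diag_mx X]; split; first exact: diag_masa.
  by move=> Y /diag_mxP[d ->]; apply: diag_talg.
move=> Y /diag_mxP[d ->] /=; split; first exact: pperm_mx_conj_diag.
have -> : v = adjmx (pperm_mx kappa rho predT) by rewrite pperm_mx_adjE.
rewrite adjmxK; exact: pperm_mx_conj_diag.
Qed.

Lemma scaleE A : scale R A = fits A.
Proof. by apply/seteqP; split=> g; [apply: scale_fits|apply: fits_scale]. Qed.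

Variables (A B : Talg r) (phi : 'M[C]_(tdim A) -> 'M[C]_(tdim B)).
Variables (I : finType) (V : I -> 'M[C]_(tdim B, tdim A)).
Variable f : I -> {ffun 'I_r -> 'I_r}.
Hypothesis phiVf : spatial phi V f.

(** The trace of the projection [defect V c] is its rank, a natural number, so the difference in
    [defect_tr] is nonnegative. *)
Lemma spatial_fit c : (\sum_i \sum_(a | f i a == c) bdim A a <= bdim B c)%N.
Proof.
have [_ VV Vf _] := phiVf.
have := defect_tr VV Vf c; rewrite selmx_tr card_blk -proj_rank; last exact:
  defect_proj.
have trE i : \tr (selmx R (fun s : 'I_(tdim A) => f i (blk A s) == c)) =
    (\sum_(a | f i a == c) bdim A a)%:R.
  by rewrite selmx_tr (card_blk_pred A (fun a => f i a == c)).
rewrite (eq_bigr _ (fun i _ => trE i)).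
rewrite -natr_sum => /eqP; rewrite eq_sym subr_eq -natrD eqr_nat => /eqP ->.
exact: leq_addl.
Qed.

Lemma Gmap_spatialE (g : utmx r) c d : utval (Gmap phi g) c d =
  \sum_a \sum_b \sum_i utval g a b *+ ((c == f i a) && (d == f i b)).
Proof.
have [f_mono _ _ _] := phiVf.
rewrite utval_sum summxE; apply: eq_bigr => a _.
rewrite utval_sum summxE big_mkcond; apply: eq_bigr => b _.
case: leqP => [le_ab|lt_ba]; last first.
  by rewrite utval_lower // big1 // => i _; rewrite mul0rn.
rewrite utvalMz (cls_spatial phiVf) // utval_sum summxE mulr_suml.
by apply: eq_bigr => i _; rewrite GunitE ?f_mono // mulr_natl.
Qed.

Lemma Gmap_fits (g : utmx r) : fits A g -> fits B (Gmap phi g).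
Proof.
case=> g_ge0 g_row g_col.
(* Used for the rows with [G] equal to [g], and for the columns with its transpose. *)
have sum_le (G : 'I_r -> 'I_r -> int) c :
    (forall a, \sum_b G a b <= (bdim A a)%:Z) ->
    \sum_a \sum_b \sum_i G a b *+ (c == f i a) <= (bdim B c)%:Z.
  move=> G_le; apply: le_trans (_ : (\sum_i \sum_(a | f i a == c) bdim A a)%:Z
    <= _);
    last by rewrite lez_nat spatial_fit.
  rewrite -natz natr_sum.
  under [leLHS]eq_bigr => a _ do rewrite exchange_big /=.
  rewrite exchange_big /=; apply: ler_sum => i _.
  rewrite natr_sum [leRHS]big_mkcond; apply: ler_sum => a _.
  rewrite eq_sym sumrMnl; case: eqP => _; last by rewrite mulr0n.
  by rewrite mulr1n natz.
split=> [c d|c|d].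
- rewrite Gmap_spatialE; apply: sumr_ge0 => a _; apply: sumr_ge0 => b _.
  by apply: sumr_ge0 => i _; apply: mulrn_wge0.
- apply: le_trans (sum_le (utval g) c g_row); rewrite le_eqVlt; apply/orP; left.
  under eq_bigr => d _ do rewrite Gmap_spatialE.
  rewrite exchange_big; apply/eqP/eq_bigr => a _.
  rewrite exchange_big; apply/eq_bigr => b _.
  rewrite exchange_big; apply/eq_bigr => i _ /=.
  rewrite (bigD1 (f i b)) //= eqxx andbT big1 ?addr0 // => d /negbTE ->.
  by rewrite andbF.
apply: le_trans (sum_le (fun b a => utval g a b) d g_col).
rewrite le_eqVlt; apply/orP; left.
under eq_bigr => c _ do rewrite Gmap_spatialE exchange_big.
rewrite exchange_big; apply/eqP/eq_bigr => b _ /=.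
rewrite exchange_big; apply/eq_bigr => a _ /=.
rewrite exchange_big; apply/eq_bigr => i _ /=.
by rewrite (bigD1 (f i a)) //= eqxx big1 ?addr0 // => c /negbTE ->.
Qed.

End ScaleConverse.

(** * Direct limits *)

Section DirectLimitMaps.
Variable V : zmodType.
Implicit Types f g : nat -> {additive V -> V}.

Lemma dl_inj_is_zmod f k : zmod_morphism (@dl_inj V f k).
Proof.
move=> x y; rewrite -[dl_inj f k x - _]/(dl_add _ (dl_opp _)).
by rewrite dl_inj_opp dl_inj_add -dl_map_add dl_inj_map.
Qed.
HB.instance Definition _ f k :=
  GRing.isZmodMorphism.Build V (dirlim f) (@dl_inj V f k) (dl_inj_is_zmod f k).

Lemma dl_inj_eq f k l x y : dl_inj f k x = dl_inj f l y ->
  exists p q, (p + k = q + l)%N /\ dl_map f k p x = dl_map f l q y.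
Proof. by move/eqP/dl_injP. Qed.

Lemma dl_inj_ge f (u : dirlim f) (K : nat -> nat) : (forall i, i <= K i)%N ->
  exists i x, u = dl_inj f (K i) x.
Proof.
move=> K_ge; case E: (repr u) => [k x].
exists k, (dl_map f k (K k - k) x).
by rewrite dl_inj_mapE ?subnK // -(dl_injK u) E.
Qed.

(** The stages [K i] are cofinal, so the values of [p] there determine the limit map. Combining the
    two triangles shows that [p] commutes with the connecting maps, whence the map is well
    defined. *)
Lemma dirlim_map_exists f g (K L d e : nat -> nat)
    (p q : nat -> {additive V -> V}) :
    (forall i, K i.+1 = d i + K i)%N -> (forall i, L i.+1 = e i + L i)%N ->
    (forall i, i <= K i)%N ->
    (forall i x, q i (p i x) = dl_map f (K i) (d i) x) ->
    (forall i y, p i.+1 (q i y) = dl_map g (L i) (e i) y) ->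
  exists Phi : {additive dirlim f -> dirlim g},
    forall i x, Phi (dl_inj f (K i) x) = dl_inj g (L i) (p i x).
Proof.
move=> KS LS K_ge qp pq; pose F i x := dl_inj g (L i) (p i x).
have FS n i : exists m, (m + K i = K (n + i))%N /\
    forall x, F (n + i)%N (dl_map f (K i) m x) = F i x.
  elim: n => [|n [m [mE FE]]]; first by exists 0%N.
  exists (d (n + i) + m)%N; split=> [|x]; first by rewrite -addnA mE addSn KS.
  rewrite dl_mapD mE -FE /F -qp addSn pq; apply: dl_inj_mapE.
  exact: LS.
have F_wd i j x y : dl_inj f (K i) x = dl_inj f (K j) y -> F i x = F j y.
  move/dl_inj_eq => [s [t [e_st e_xy]]].
  (* Both representatives are pushed to the common stage [K (s + K i + j + i)], late enough for them
     to have become equal. *)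
  have [m [mE FmE]] := FS (s + K i + j)%N i.
  have [n [nE FnE]] := FS (s + K i + i)%N j.
  rewrite addnAC in nE FnE; rewrite -FmE -FnE.
  have le_sm : (s <= m)%N.
    rewrite -(leq_add2r (K i)) mE; apply: leq_trans (K_ge _).
    by rewrite -(addnA (s + K i)) leq_addr.
  have eq_mn : (m + K i = n + K j)%N by rewrite mE nE.
  have le_tn : (t <= n)%N by rewrite -(leq_add2r (K j)) -e_st -eq_mn leq_add2r.
  congr (F _ _); rewrite -(subnK le_sm) -(subnK le_tn) !dl_mapD e_xy e_st.
  congr (dl_map _ _ _ _); apply: (@addIn (s + K i)%N).
  by rewrite [in RHS]e_st !addnA !subnK.
have /choice[c cP] (u : dirlim f) : exists ix : nat * V, u = dl_inj f (K ix.1) ix.2.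
  by have [i [x ->]] := dl_inj_ge u K_ge; exists (i, x).
pose Phi u := F (c u).1 (c u).2.
have PhiE i x : Phi (dl_inj f (K i) x) = F i x by apply: F_wd; rewrite -cP.
have Phi_zmod : zmod_morphism Phi.
  move=> u v; have [i [x ->]] := dl_inj_ge u K_ge.
  have [j [y ->]] := dl_inj_ge v K_ge.
  have [m [mE _]] := FS j i; have [n [nE _]] := FS i j.
  rewrite -(dl_inj_map f (K i) m) -(dl_inj_map f (K j) n) mE nE [(i + j)%N]addnC.
  by rewrite -raddfB !PhiE /F !raddfB.
pose Phi' : {additive dirlim f -> dirlim g} :=
  HB.pack Phi (GRing.isZmodMorphism.Build _ _ Phi Phi_zmod).
by exists Phi'.
Qed.

Lemma dirlim_iso_exists f g (K L d e : nat -> nat)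
    (p q : nat -> {additive V -> V}) :
    (forall i, K i.+1 = d i + K i)%N -> (forall i, L i.+1 = e i + L i)%N ->
    (forall i, i <= K i)%N -> (forall i, i <= L i)%N ->
    (forall i x, q i (p i x) = dl_map f (K i) (d i) x) ->
    (forall i y, p i.+1 (q i y) = dl_map g (L i) (e i) y) ->
  exists (Phi : {additive dirlim f -> dirlim g}) (Psi : {additive dirlim g ->
    dirlim f}),
    [/\ cancel Phi Psi, cancel Psi Phi,
        forall i x, Phi (dl_inj f (K i) x) = dl_inj g (L i) (p i x) &
        forall i y, Psi (dl_inj g (L i) y) = dl_inj f (K i.+1) (q i y)].
Proof.
move=> KS LS K_ge L_ge qp pq.
have [Phi PhiE] := dirlim_map_exists KS LS K_ge qp pq.
(* The same ladder read from its second rung: [q i] comes first, followed by [p i.+1]. *)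
have [Psi PsiE] := dirlim_map_exists (K := L) (L := K \o succn)
  (e := d \o succn) (q := p \o succn) LS (fun i => KS i.+1) L_ge pq (fun i =>
    qp i.+1).
exists Phi, Psi; split=> // u.
  have [i [x ->]] := dl_inj_ge u K_ge.
  by rewrite PhiE PsiE qp; apply: dl_inj_mapE; apply: KS.
have [i [y ->]] := dl_inj_ge u L_ge.
by rewrite PsiE /= PhiE pq; apply: dl_inj_mapE; apply: LS.
Qed.

End DirectLimitMaps.

(** * Connecting maps of a system and what regular maps preserve *)

Section Systems.
Variable R : realType.
Local Notation C := R[i].
Variable r : nat.
Hypothesis r_gt0 : (0 < r)%N.
Implicit Types S T : system R r.

Lemma blockwise1 (A : Talg r) :
  blockwise (1%:M : 'M[C]_(tdim A)) [ffun a : 'I_r => a].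
Proof.
by move=> j s; rewrite mxE ffunE; case: (j =P s) => [->|_] //; rewrite eqxx.
Qed.

Lemma conj_spatial (A : Talg r) (U : 'M[C]_(tdim A)) :
    adjmx U *m U = 1%:M -> blockwise U [ffun a : 'I_r => a] ->
  spatial (fun X => U *m X *m adjmx U) (fun _ : unit => U)
    (fun _ => [ffun a : 'I_r => a]).
Proof.
move=> UU Ub; split=> [_ a b|[] []|_|X _] //; first by rewrite !ffunE.
by rewrite big_const card_unit /= addr0.
Qed.

(** There is one summand and its block map is the identity, so unitary corrections are invisible to
    the invariant. *)
Lemma conj_Gmap (A : Talg r) (U : 'M[C]_(tdim A)) x :
    adjmx U *m U = 1%:M -> blockwise U [ffun a : 'I_r => a] ->
  Gmap (fun X => U *m X *m adjmx U) x = x.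
Proof.
move=> UU Ub; apply: (@utmx_additive_ext _ _ (Gmap _) idfun) => a b le_ab /=.
rewrite (Gmap_spatial (conj_spatial UU Ub)) //.
by rewrite big_const card_unit /= !ffunE addr0.
Qed.

Lemma id_spatial (A : Talg r) : spatial (fun X : 'M[C]_(tdim A) => X)
  (fun _ : unit => 1%:M) (fun _ => [ffun a : 'I_r => a]).
Proof.
have UU : adjmx 1%:M *m 1%:M = 1%:M :> 'M[C]_(tdim A) by rewrite mulmx1 adjmx1.
have [? ? ? h] := conj_spatial UU (@blockwise1 A); split=> // X AX.
by rewrite -h // mul1mx adjmx1 mulmx1.
Qed.

Lemma strans_regular S k d : regular (@strans _ _ S k d).
Proof.
elim: d => [|d IHd] /=; first exact: spatial_regular (id_spatial _).
by apply: (regular_comp r_gt0 IHd); apply: smap_regular.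
Qed.

Lemma dl_map_Gmap S k d x : dl_map (Gseq S) k d x = Gmap (@strans _ _ S k d) x.
Proof.
elim: d x => [|d IHd] x /=; last first.
  rewrite IHd -(Gmap_comp r_gt0) //; first exact: strans_regular.
  exact: smap_regular.
apply: (@utmx_additive_ext _ _ idfun (Gmap (@strans _ _ S k 0))) => a b le_ab /=.
rewrite (Gmap_spatial (id_spatial _)) // big_const card_unit /= !ffunE.
by rewrite addr0.
Qed.

Lemma regular_fits (A B : Talg r) (phi : 'M[C]_(tdim A) -> 'M[C]_(tdim B)) g :
  regular phi -> fits A g -> fits B (Gmap phi g).
Proof. by move=> /(regularE r_gt0)[N [V [f Vf]]]; move=> ?; apply: (Gmap_fits
  Vf). Qed.

Lemma regular_mu_scale (A B : Talg r) (phi : 'M[C]_(tdim A) -> 'M[C]_(tdim B)) s :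
  regular phi -> mu_scale R A s -> mu_scale R B (Gmap phi \o s).
Proof.
move=> phi_reg [chi chi_reg <-]; exists (phi \o chi); first exact: regular_comp.
apply/funext => -[[a b] /= le_ab].
by rewrite -(Gmap_Gunit chi le_ab) -(Gmap_comp r_gt0) // Gmap_Gunit.
Qed.

Lemma Gmap_ge0 (A B : Talg r) (phi : 'M[C]_(tdim A) -> 'M[C]_(tdim B)) g :
  utmx_ge0 g -> utmx_ge0 (Gmap phi g).
Proof.
move=> g_ge0 c d; rewrite utval_sum summxE; apply: sumr_ge0 => a _.
rewrite utval_sum summxE; apply: sumr_ge0 => b _.
by rewrite utvalMz mulr_ge0 // mxE; case: ifP.
Qed.

End Systems.

(** * The invariant of regularly isomorphic systems *)

Section Forward.
Variable R : realType.
Local Notation C := R[i].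
Variable r : nat.
Hypothesis r_gt0 : (0 < r)%N.
Implicit Types S T : system R r.

Lemma subidx_ge d i : (i <= subidx d i)%N.
Proof. by elim: i => //= i IHi; rewrite addSn ltnS (leq_trans IHi) ?leq_addl. Qed.

(** An element of stage [k] moves to the later stage [K k] by a connecting map, which preserves
    cone, scale and matrix unit scale; so only the stages [K i] need checking. *)
Lemma dirlim_scaled_sub S T (K L : nat -> nat) (p : nat -> {additive utmx r ->
  utmx r})
    (Phi : {additive G S -> G T}) :
    (forall i, i <= K i)%N ->
    (forall i x, Phi (Ginj S (K i) x) = Ginj T (L i) (p i x)) ->
    (forall i x, utmx_ge0 x -> utmx_ge0 (p i x)) ->
    (forall i x, fits (alg S (K i)) x -> fits (alg T (L i)) (p i x)) ->
    (forall i s, mu_scale R (alg S (K i)) s -> mu_scale R (alg T (L i)) (p i \o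
      s)) ->
  [/\ Phi @` Gpos S `<=` Gpos T, Phi @` Gscale S `<=` Gscale T &
      [set (Phi \o s : upair r -> G T) | s in Gmu_scale S] `<=` Gmu_scale T].
Proof.
move=> K_ge PhiE p_ge0 p_fits p_mu.
have push k x : Ginj S k x = Ginj S (K k) (dl_map (Gseq S) k (K k - k) x).
  by rewrite /Ginj dl_inj_mapE // subnK.
have reg k : regular (@strans _ _ S k (K k - k)) by apply: strans_regular.
split=> [_ [_ [k _ [x x_ge0 <-]] <-]|_ [_ [k _ [x xS <-]] <-]|_ [_ [k _ [s sS
  <-]] <-]].
- exists (L k) => //; exists (p k (dl_map (Gseq S) k (K k - k) x)); last first.
    by rewrite push PhiE.
  by apply: p_ge0; rewrite dl_map_Gmap //; apply: Gmap_ge0.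
- exists (L k) => //; exists (p k (dl_map (Gseq S) k (K k - k) x)); last first.
    by rewrite push PhiE.
  rewrite scaleE; apply: p_fits; rewrite scaleE in xS.
  have := regular_fits r_gt0 (reg k) xS; rewrite -dl_map_Gmap //.
  by rewrite subnK.
- exists (L k) => //; exists (p k \o (dl_map (Gseq S) k (K k - k) \o s)); last
  first.
    by apply/funext => ab /=; rewrite [in RHS]push PhiE.
  apply: p_mu; have := regular_mu_scale r_gt0 (reg k) sS.
  rewrite (_ : Gmap _ \o s = dl_map (Gseq S) k (K k - k) \o s); last first.
    by apply/funext => ab /=; rewrite dl_map_Gmap.
  by rewrite subnK.
Qed.

Lemma regularly_isomorphic_invariant S T : regularly_isomorphic S T ->
  exists Phi : {additive G S -> G T},
    scaled_order_iso Phi /\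
    [set (Phi \o s : upair r -> G T) | s in Gmu_scale S] = Gmu_scale T.
Proof.
move=> [d [e [phi [psi [phi_reg psi_reg psiphi phipsi]]]]].
have Gcomp (A B D : Talg r) (u : 'M[C]_(tdim A) -> 'M[C]_(tdim B))
    (w : 'M[C]_(tdim B) -> 'M[C]_(tdim D)) (z : 'M[C]_(tdim A) -> 'M[C]_(tdim
      D)) x :
    regular u -> regular w -> (forall X, talg R A X -> w (u X) = z X) ->
    Gmap w (Gmap u x) = Gmap z x.
  move=> u_reg w_reg wuz; rewrite -(Gmap_comp r_gt0) //.
  apply: (@utmx_additive_ext _ _ (Gmap (w \o u)) (Gmap z)) => a b le_ab /=.
  by rewrite !Gmap_Gunit //= wuz //; apply: talg_munit.
(* The shift in [L] reflects that [phi i] lands in term [i.+1] of the subsystem of [T]. *)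
pose K := subidx d; pose L i := subidx e i.+1.
pose p i : {additive utmx r -> utmx r} := Gmap (phi i).
pose q i : {additive utmx r -> utmx r} := Gmap (psi i).
have qp i x : q i (p i x) = dl_map (Gseq S) (K i) (d i).+1 x.
  rewrite dl_map_Gmap //; apply: Gcomp (phi_reg i) (psi_reg i) _ => X AX.
  exact: psiphi.
have pq i y : p i.+1 (q i y) = dl_map (Gseq T) (L i) (e i.+1).+1 y.
  rewrite dl_map_Gmap //; apply: Gcomp (psi_reg i) (phi_reg i.+1) _ => X AX.
  exact: phipsi.
have K_ge i : (i <= K i)%N by apply: subidx_ge.
have L_ge i : (i <= L i)%N by apply: leq_trans (subidx_ge e i.+1).
have [Phi [Psi [PhiK PsiK PhiE PsiE]]] := dirlim_iso_exists
  (fun i => erefl : K i.+1 = (d i).+1 + K i)%N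
  (fun i => erefl : L i.+1 = (e i.+1).+1 + L i)%N K_ge L_ge qp pq.
have [Phi_pos Phi_scale Phi_mu] : [/\ Phi @` Gpos S `<=` Gpos T,
    Phi @` Gscale S `<=` Gscale T &
    [set (Phi \o s : upair r -> G T) | s in Gmu_scale S] `<=` Gmu_scale T].
  apply: (dirlim_scaled_sub K_ge PhiE) => i x.
  - exact: Gmap_ge0.
  - exact: (regular_fits r_gt0 (phi_reg i)).
  - exact: (regular_mu_scale r_gt0 (phi_reg i)).
have [Psi_pos Psi_scale Psi_mu] : [/\ Psi @` Gpos T `<=` Gpos S,
    Psi @` Gscale T `<=` Gscale S &
    [set (Psi \o s : upair r -> G S) | s in Gmu_scale T] `<=` Gmu_scale S].
  apply: (@dirlim_scaled_sub T S L (K \o succn) q Psi L_ge PsiE) => i x.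
  - exact: Gmap_ge0.
  - exact: (regular_fits r_gt0 (psi_reg i)).
  - exact: (regular_mu_scale r_gt0 (psi_reg i)).
exists Phi; split; first split.
- by exists Psi.
- apply/seteqP; split=> // u Tu; exists (Psi u); last exact: PsiK.
  by apply: Psi_pos; exists u.
- apply/seteqP; split=> // u Tu; exists (Psi u); last exact: PsiK.
  by apply: Psi_scale; exists u.
apply/seteqP; split=> // s Ts; exists (Psi \o s).
  by apply: Psi_mu; exists s.
by apply/funext => ab /=; apply: PsiK.
Qed.

End Forward.

(** * Lifting isomorphisms of the invariant *)

Section Backward.
Variable R : realType.
Local Notation C := R[i].
Variable r : nat.
Hypothesis hr : r = 2%N \/ r = 3%N.
Implicit Types S T : system R r.
Implicit Types A B : Talg r.

Let r_gt0 : (0 < r)%N. Proof. by case: hr => ->. Qed.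

(** Equal induced maps give equal pair counts, hence for [r] equal to 2 or 3 a matching of the
    summands with the same block maps; after reindexing, [spatial_unitary] applies. *)
Lemma regular_unitary A B (phi phi' : 'M[C]_(tdim A) -> 'M[C]_(tdim B)) :
    regular phi -> regular phi' ->
    (forall a b : 'I_r, (a <= b)%N -> Gmap phi (Gunit a b) = Gmap phi' (Gunit a
      b)) ->
  exists U : 'M[C]_(tdim B), [/\ adjmx U *m U = 1%:M,
    blockwise U [ffun a : 'I_r => a] &
    forall X, talg R A X -> phi' X = U *m phi X *m adjmx U].
Proof.
move=> /(regularE r_gt0)[N [V [f Vf]]] /(regularE r_gt0)[N' [V' [f' Vf']]] eqG.
have [f_mono _ _ _] := Vf; have [f'_mono VV' Vf'b phiE'] := Vf'.
have [s s_bij fs] : exists2 s : 'I_N -> 'I_N', bijective s & forall i, f' (s i)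
  = f i.
  apply: (equidistributed_bij f_mono f'_mono) => g g_mono.
  apply: equidistributed_point g_mono => // a b le_ab.
  by rewrite -(Gmap_spatial Vf) // -(Gmap_spatial Vf') // eqG.
apply: spatial_unitary Vf (_ : spatial phi' (V' \o s) f).
split=> // [i j|i|X AX] /=; first by rewrite VV' (inj_eq (bij_inj s_bij)).
  by rewrite -fs; apply: Vf'b.
by rewrite phiE' // (reindex s) //; apply: onW_bij.
Qed.

(** Realised by embedding [Tr r] with the identity block map; every block of [A] is nonempty, so it
    fits. *)
Lemma Gunit_mu_scale A : mu_scale R A (fun ab : upair r => Gunit (val ab).1
  (val ab).2).
Proof.
have [|c|phi [V Vf]] := @spatial_exists R r (Tr r) A unit (fun _ => [ffun a => a]).
- by move=> _ a b; rewrite !ffunE.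
- rewrite big_const card_unit /= addn0.
  under eq_bigl => a do rewrite ffunE.
  by rewrite big_pred1_eq /= bdim_gt0.
exists phi; first exact: spatial_regular Vf.
apply/funext => -[[a b] /= le_ab]; rewrite (cls_spatial Vf) //.
by rewrite big_const card_unit /= addr0 !ffunE.
Qed.

(** The class of the identity of [A]; its image measures the room that a regular map out of [A]
    takes up. *)
Definition unit_class A : utmx r := \sum_a Gunit a a *+ bdim A a.

Lemma utvalMn (x : utmx r) n c d : utval (x *+ n) c d = utval x c d *+ n.
Proof. by rewrite pmulrn utvalMz -natz mulr_natr. Qed.

Lemma unit_classE A c d :
  utval (unit_class A) c d = if c == d then (bdim A c)%:Z else 0.
Proof.
rewrite utval_sum summxE (bigD1 c) //= big1 => [|a ne_ac].
  rewrite utvalMn GunitE // eqxx addr0 /=; rewrite eq_sym.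
  by case: eqP => _; rewrite ?mul0rn // -natz.
by rewrite utvalMn GunitE // eq_sym (negbTE ne_ac) mul0rn.
Qed.

Lemma unit_class_fits A : fits A (unit_class A).
Proof.
split=> [c d|c|d]; first by rewrite unit_classE; case: ifP.
  under eq_bigr => d _ do rewrite unit_classE.
  by rewrite -big_mkcond /= (eq_bigl (pred1 c)) ?big_pred1_eq // => d; rewrite
    /= eq_sym.
under eq_bigr => c _ do rewrite unit_classE.
by rewrite -big_mkcond big_pred1_eq.
Qed.

(** The matrix unit scale yields a regular [chi] out of [Tr r], hence a family of block maps; the
    scale, applied to the unit class, provides room to use this family on the larger algebra [A]. *)
Lemma regular_lift S T (Phi : {additive G S -> G T}) k :
    Phi @` Gscale S `<=` Gscale T ->
    [set (Phi \o s : upair r -> G T) | s in Gmu_scale S] `<=` Gmu_scale T ->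
  exists l (phi : 'M[C]_(tdim (alg S k)) -> 'M[C]_(tdim (alg T l))),
    regular phi /\ forall x, Ginj T l (Gmap phi x) = Phi (Ginj S k x).
Proof.
move=> Phi_scale Phi_mu; pose A := alg S k.
pose s0 := fun ab : upair r => Gunit (val ab).1 (val ab).2.
have [l1 _ [_ [chi chi_reg <-] chiE]] : Gmu_scale T (Phi \o (Ginj S k \o s0)).
  apply: Phi_mu; exists (Ginj S k \o s0) => //; exists k => //; exists s0 => //.
  exact: Gunit_mu_scale.
(* The groups of [Tr r] and [A] are both T_r(Z) with the same generators, so [Gmap chi] represents
   [Phi] on the classes of [A]. *)
have {}chiE x : Ginj T l1 (Gmap chi x) = Phi (Ginj S k x).
  apply: (@utmx_additive_ext _ _ (@dl_inj _ (Gseq T) l1 \o Gmap chi)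
    (Phi \o @dl_inj _ (Gseq S) k)) => a b le_ab.
  have /(congr1 (@^~ (exist _ (a, b) le_ab))) := chiE.
  by rewrite /= Gmap_Gunit.
have [l2 _ [g gT gE]] : Gscale T (Phi (Ginj S k (unit_class A))).
  apply: Phi_scale; exists (Ginj S k (unit_class A)) => //; exists k => //.
  by exists (unit_class A) => //; rewrite scaleE; apply: unit_class_fits.
(* Equality in the limit holds from some stage on; there the image of the unit class is also the
   image of an element of a scale, so it fits. *)
move: gE; rewrite -chiE => /dl_inj_eq[q [p [e_pq gE]]].
pose chi' := @strans _ _ T l1 p \o chi.
have chi'_reg : regular chi'.
  by apply: regular_comp => //; apply: strans_regular.
have chi'E x : Gmap chi' x = dl_map (Gseq T) l1 p (Gmap chi x).
  by rewrite dl_map_Gmap // -Gmap_comp //; apply: strans_regular.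
have fit : fits (alg T (p + l1)) (Gmap chi' (unit_class A)).
  rewrite chi'E -gE -e_pq dl_map_Gmap //.
  apply: regular_fits => //; first exact: strans_regular.
  by rewrite scaleE in gT.
have [N [V [f Vf]]] := regularE r_gt0 chi'_reg.
have [f_mono _ _ _] := Vf.
have [//|c|phi [W Wf]] := @spatial_exists R r A (alg T (p + l1)) _ f.
  (* The diagonal entry at [c] of the image of the unit class is the dimension that the family [f]
     requires in block [c]. *)
  have [g_ge0 g_row _] := fit; rewrite -lez_nat; apply: le_trans (g_row c).
  rewrite (bigD1 c) //= -[leLHS]addr0; apply: lerD; last by apply: sumr_ge0.
  rewrite (Gmap_spatialE Vf) -natz natr_sum le_eqVlt; apply/orP; left; apply/eqP.
  transitivity (\sum_a \sum_i (bdim A a)%:Z *+ (f i a == c)).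
    rewrite exchange_big; apply: eq_bigr => i _; rewrite natr_sum big_mkcond.
    by apply: eq_bigr => a _; case: eqP => _; rewrite ?mulr0n // natz.
  apply: eq_bigr => a _; rewrite (bigD1 a) //= [X in _ + X]big1 => [|b ne_ba].
    by rewrite addr0; apply: eq_bigr => i _; rewrite unit_classE eqxx andbb eq_sym.
  by rewrite big1 // => i _; rewrite unit_classE eq_sym (negbTE ne_ba) mul0rn.
exists (p + l1)%N, phi; split; first exact: spatial_regular Wf.
move=> x; rewrite -chiE /Ginj -(dl_inj_map (Gseq T) l1 p) -chi'E.
congr (dl_inj _ _ _).
apply: (@utmx_additive_ext _ _ (Gmap phi) (Gmap chi')) => a b le_ab /=.
by rewrite (Gmap_spatial Wf) // (Gmap_spatial Vf).
Qed.

(** A lift of [Psi] composed with [phi] agrees on the invariant, at a late stage, with the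
    connecting map; a block diagonal unitary then makes the triangle commute exactly. *)
Lemma regular_triangle S T (Phi : {additive G S -> G T}) (Psi : {additive G T
  -> G S})
    k l (phi : 'M[C]_(tdim (alg S k)) -> 'M[C]_(tdim (alg T l))) :
    Psi @` Gscale T `<=` Gscale S ->
    [set (Psi \o s : upair r -> G S) | s in Gmu_scale T] `<=` Gmu_scale S ->
    cancel Phi Psi -> regular phi ->
    (forall x, Ginj T l (Gmap phi x) = Phi (Ginj S k x)) ->
  exists d (psi : 'M[C]_(tdim (alg T l)) -> 'M[C]_(tdim (alg S (d.+1 + k)))),
    [/\ regular psi,
        forall y, Ginj S (d.+1 + k) (Gmap psi y) = Psi (Ginj T l y) &
        forall X, talg R (alg S k) X -> psi (phi X) = @strans _ _ S k d.+1 X].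
Proof.
move=> Psi_scale Psi_mu PhiK phi_reg phiE.
have [m [psi0 [psi0_reg psi0E]]] := regular_lift l Psi_scale Psi_mu.
have /choice[P /choice[Q PQ]] (ab : 'I_r * 'I_r) : exists p q,
    (p + m = q + k)%N /\
    dl_map (Gseq S) m p (Gmap psi0 (Gmap phi (Gunit ab.1 ab.2))) =
    dl_map (Gseq S) k q (Gunit ab.1 ab.2).
  by apply: dl_inj_eq; have := psi0E (Gmap phi (Gunit ab.1 ab.2)); rewrite phiE
    PhiK.
(* The sum bounds the stages needed by the finitely many generators; adding [k.+1] makes the target
   index exceed [k]. *)
pose N := (\sum_ab P ab + k.+1)%N.
have [d dE] : exists d, (N + m = d.+1 + k)%N.
  exists (\sum_ab P ab + m)%N; rewrite /N.
  by rewrite addSn -addnA addSn addnS [(k + m)%N]addnC addnA.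
have PhiPsi a b : dl_map (Gseq S) m N (Gmap psi0 (Gmap phi (Gunit a b))) =
    dl_map (Gseq S) k d.+1 (Gunit a b).
  have [ePQ eqPQ] := PQ (a, b).
  have le_PN : (P (a, b) <= N)%N.
    by rewrite /N (bigD1 (a, b)) //= -addnA leq_addr.
  have le_Qd : (Q (a, b) <= d.+1)%N.
    by rewrite -(leq_add2r k) -ePQ -dE leq_add2r.
  rewrite -(subnK le_PN) -(subnK le_Qd) !dl_mapD eqPQ ePQ.
  congr (dl_map _ _ _ _); apply: (@addIn (P (a, b) + m)%N).
  by rewrite [in RHS]ePQ !addnA !subnK.
(* The index [d.+1 + k] equals [N + m] only by a proof; rewriting inside the existential statement
   moves the target without a cast. *)
have [psi1 [psi1_reg psi1E]] : exists psi1 : 'M[C]_(tdim (alg T l)) ->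
      'M[C]_(tdim (alg S (d.+1 + k))),
    regular psi1 /\ forall y, Gmap psi1 y = dl_map (Gseq S) m N (Gmap psi0 y).
  rewrite -dE; exists (@strans _ _ S m N \o psi0).
  have Sreg := strans_regular r_gt0 S m N.
  split=> [|y]; first exact: regular_comp.
  by rewrite Gmap_comp // dl_map_Gmap.
have Sreg := strans_regular r_gt0 S k d.+1.
have [|a b le_ab|U [UU Ub UE]] := @regular_unitary _ _ (psi1 \o phi)
    (@strans _ _ S k d.+1) _ Sreg.
- exact: regular_comp.
- by rewrite Gmap_comp // psi1E PhiPsi dl_map_Gmap.
have Ureg := spatial_regular (conj_spatial UU Ub).
exists d, ((fun X => U *m X *m adjmx U) \o psi1); split.
- exact: regular_comp.
- move=> y; rewrite Gmap_comp // conj_Gmap // psi1E -psi0E.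
  by rewrite /Ginj dl_inj_mapE.
- by move=> X AX; rewrite UE.
Qed.

(* The indices reached by the construction agree with [subidx] by a proof only,
   not by computation, so the triangles are stated in sigma types. *)
Lemma interleaved_regularly_isomorphic S T (K L d e : nat -> nat)
    (phi : forall i, 'M[C]_(tdim (alg S (K i))) -> 'M[C]_(tdim (alg T (L i))))
    (psi : forall i, 'M[C]_(tdim (alg T (L i))) -> 'M[C]_(tdim (alg S (K i.+1)))) :
    (forall i, K i = subidx d i) -> (forall i, L i = subidx e i.+1) ->
    (forall i, regular (phi i)) -> (forall i, regular (psi i)) ->
    (forall i X, talg R (alg S (K i)) X ->
      existT (fun n => 'M[C]_(tdim (alg S n))) (K i.+1) (psi i (phi i X)) =
      existT _ ((d i).+1 + K i)%N (@strans _ _ S (K i) (d i).+1 X)) ->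
    (forall i Y, talg R (alg T (L i)) Y ->
      existT (fun n => 'M[C]_(tdim (alg T n))) (L i.+1) (phi i.+1 (psi i Y)) =
      existT _ ((e i.+1).+1 + L i)%N (@strans _ _ T (L i) (e i.+1).+1 Y)) ->
  regularly_isomorphic S T.
Proof.
move=> /funext KE /funext LE; subst K; subst L => phi_reg psi_reg psiphi phipsi.
exists d, e, phi, psi; split=> // i X AX.
  exact: (Eqdep_dec.inj_pair2_eq_dec _ (@eq_comparable nat)) (psiphi i X AX).
exact: (Eqdep_dec.inj_pair2_eq_dec _ (@eq_comparable nat)) (phipsi i X AX).
Qed.

(** One rung of the intertwining, with its indices kept as data so that the construction can be
    iterated. *)
Record link S T (Phi : G S -> G T) := Link {
  lsrc : nat;
  ltgt : nat;
  lmap : 'M[C]_(tdim (alg S lsrc)) -> 'M[C]_(tdim (alg T ltgt));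
  lmap_regular : regular lmap;
  lmapE : forall x, Ginj T ltgt (Gmap lmap x) = Phi (Ginj S lsrc x)
}.

(** Gaps are stored minus one, so that indices strictly increase and the targets have literally the
    form used by [strans]. *)
Record link_step S T (Phi : G S -> G T) (x : link Phi) := LinkStep {
  sgap : nat;
  tgap : nat;
  sback : 'M[C]_(tdim (alg T (ltgt x))) -> 'M[C]_(tdim (alg S (sgap.+1 + lsrc x)));
  snext : 'M[C]_(tdim (alg S (sgap.+1 + lsrc x))) -> 'M[C]_(tdim (alg T
    (tgap.+1 + ltgt x)));
  sback_regular : regular sback;
  snext_regular : regular snext;
  snextE : forall z, Ginj T (tgap.+1 + ltgt x) (Gmap snext z) = Phi (Ginj S
    (sgap.+1 + lsrc x) z);
  sback_lmap : forall X, talg R (alg S (lsrc x)) X ->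
    sback (@lmap _ _ _ x X) = @strans _ _ S (lsrc x) sgap.+1 X;
  snext_sback : forall Y, talg R (alg T (ltgt x)) Y ->
    snext (sback Y) = @strans _ _ T (ltgt x) tgap.+1 Y
}.

Lemma invariant_regularly_isomorphic S T (Phi : {additive G S -> G T}) :
    scaled_order_iso Phi ->
    [set (Phi \o s : upair r -> G T) | s in Gmu_scale S] = Gmu_scale T ->
  regularly_isomorphic S T.
Proof.
move=> [[Psi0 PhiK PsiK] Phi_pos Phi_scale] Phi_mu.
have Psi_zmod : zmod_morphism Psi0.
  by move=> u v; apply: (can_inj PhiK); rewrite raddfB !PsiK.
pose Psi : {additive G T -> G S} :=
  HB.pack Psi0 (GRing.isZmodMorphism.Build _ _ Psi0 Psi_zmod).
have Psi_scale : Psi @` Gscale T `<=` Gscale S.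
  by move=> _ [u + <-]; rewrite -Phi_scale => -[w Sw <-]; rewrite /= PhiK.
have Psi_mu : [set (Psi \o s : upair r -> G S) | s in Gmu_scale T] `<=` Gmu_scale S.
  move=> _ [u + <-]; rewrite -Phi_mu => -[w Sw <-].
  by rewrite (_ : Psi \o _ = w) //; apply/funext => ab /=; apply: PhiK.
have Phi_scale' : Phi @` Gscale S `<=` Gscale T by rewrite Phi_scale.
have Phi_mu' : [set (Phi \o s : upair r -> G T) | s in Gmu_scale S] `<=`
  Gmu_scale T.
  by rewrite Phi_mu.
have step (x : link Phi) : link_step x.
  have /cid[d /cid[psi [psi_reg psiE psiphi]]] := @regular_triangle S T Phi Psi _ _
    (@lmap _ _ _ x) Psi_scale Psi_mu PhiK (lmap_regular x) (@lmapE _ _ _ x).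
  have /cid[e /cid[phi [phi_reg phiE phipsi]]] := @regular_triangle T S Psi Phi _ _
    psi Phi_scale' Phi_mu' PsiK psi_reg psiE.
  exact: (LinkStep psi_reg phi_reg phiE psiphi phipsi).
have /cid[l /cid[phi0 [phi0_reg phi0E]]] := regular_lift 0 Phi_scale' Phi_mu'.
(* In the subsystem of [T] the term after the first has positive index, so [phi0] is followed by one
   connecting map. *)
have phi0'_reg : regular (@strans _ _ T l 1 \o phi0).
  by apply: regular_comp => //; apply: strans_regular.
have phi0'E x : Ginj T (1 + l) (Gmap (@strans _ _ T l 1 \o phi0) x) = Phi (Ginj
  S 0 x).
  rewrite Gmap_comp //; last exact: strans_regular.
  by rewrite -phi0E -dl_map_Gmap // /Ginj dl_inj_map.
pose next x : link Phi := Link (snext_regular (step x)) (@snextE _ _ _ _ (step x)).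
pose chain i := iter i next (Link phi0'_reg phi0'E).
pose d i := sgap (step (chain i)).
(* The gap [l] places the first target at [l.+1]; later gaps come from the steps, shifted by one. *)
pose e i := if i is i'.+1 then tgap (step (chain i')) else l.
apply: (@interleaved_regularly_isomorphic S T (fun i => lsrc (chain i))
  (fun i => ltgt (chain i)) d e (fun i => @lmap _ _ _ (chain i))
  (fun i => sback (step (chain i)))).
- by elim=> //= i ->.
- elim=> [|i IHi]; first by rewrite /= addn0.
  by rewrite -[LHS]/((e i.+1).+1 + ltgt (chain i))%N IHi.
- by move=> i; apply: lmap_regular.
- by move=> i; apply: sback_regular.
- by move=> i X AX; rewrite -sback_lmap.
- by move=> i Y AY; rewrite -snext_sback.
Qed.

End Backward.

Theorem theorem3p6 (R : realType) (r : nat) (hr : r = 2%N \/ r = 3%N)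
    (S T : system R r) :
  regularly_isomorphic S T <->
  exists Phi : {additive G S -> G T},
    scaled_order_iso Phi /\
    [set (Phi \o s : upair r -> G T) | s in Gmu_scale S] = Gmu_scale T.
Proof.
split=> [|[Phi [Phi_iso Phi_mu]]].
  by apply: regularly_isomorphic_invariant; case: hr => ->.
exact: (invariant_regularly_isomorphic hr Phi_iso Phi_mu).
Qed.
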